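(* Let $\mathscr P(W)$ be the set of model triples described in the context. Then: (i) for every integer $m\ge 1$, $\mathscr P(S_m)$ is a perfect model for $S_m$; (ii) for every integer $n\ge 2$, $\mathscr P(W^{\mathsf{BC}}_n)$ is a perfect model for $W^{\mathsf{BC}}_n$; (iii) for every integer $n\ge 2$, $\mathscr P(W^{\mathsf D}_{2n+1})$ is a perfect model for $W^{\mathsf D}_{2n+1}$.
   Context: Let $(W,S)$ be a finite Coxeter system with length function $\ell$ and reflections $T=\{wsw^{-1}:w\in W,s\in S\}$. Let $\mathrm{Aut}(W,S)$ be the group of automorphisms $\varphi$ of $W$ with $\varphi(S)=S$, and $W^+=W\rtimes\mathrm{Aut}(W,S)$ the group of pairs $(w,\varphi)$ with product $(v,\alpha)(w,\beta)=(v\,\alpha(w),\alpha\beta)$; set $\ell(w,\varphi)=\ell(w)$ and identify $w\in W$ with $(w,1)$. An element $z\in W^+$ is a perfect involution if $z^2=1$ and $(zt)^4=1$ for all $t\in T$. For $J\subseteq S$ let $W_J=\langle J\rangle$ (a Coxeter system $(W_J,J)$ with the restricted length), let $\mathscr I_J$ be the set of perfect involutions in $(W_J)^+=W_J\rtimes\mathrm{Aut}(W_J,J)$, on which $W_J$ acts by conjugation $v:(y,\theta)\mapsto(v\,y\,\theta(v)^{-1},\theta)$; $z\in\mathscr I_J$ is $W_J$-minimal if $\ell(szs)\ge\ell(z)$ for all $s\in J$. For $z\in\mathscr I_J$, $C_{W_J}(z)=\{w\in W_J: wz=zw\}$. A model triple $(J,z_{\min},\sigma)$ for $W$ consists of $J\subseteq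 S$, a $W_J$-minimal $z_{\min}\in\mathscr I_J$, and a group homomorphism $\sigma:W_J\to\{\pm1\}$. A set $\mathscr P$ of model triples is a perfect model for $W$ if $\sum_{(J,z_{\min},\sigma)\in\mathscr P}\mathrm{Ind}_{C_{W_J}(z_{\min})}^W\mathrm{Res}^{W_J}_{C_{W_J}(z_{\min})}(\sigma)=\sum_{\chi\in\mathrm{Irr}(W)}\chi$, where $\mathrm{Irr}(W)$ is the set of complex irreducible characters. Classical groups: for $i>0$ let $s_i=(i,i+1)(-i,-i-1)$, $s_0=(-1,1)$, $s_{-1}=(1,-2)(-1,2)$, as permutations of $\{\pm1,\dots,\pm N\}$. $W^{\mathsf{BC}}_N$ is the group of permutations $w$ of $\{\pm1,\dots,\pm N\}$ with $w(-i)=-w(i)$, a Coxeter group with generators $s_0,s_1,\dots,s_{N-1}$; $W^{\mathsf D}_N$ is its subgroup of $w$ with $|\{i\in[N]:w(i)<0\}|$ even, a Coxeter group with generators $s_{-1},s_1,\dots,s_{N-1}$; $S_N=\langle s_1,\dots,s_{N-1}\rangle$ is the symmetric group. Write $\mathbb 1$ for trivial characters and $\mathrm{sgn}:w\mapsto(-1)^{\ell(w)}$. $\mathscr P(W)$ consists of the following triples. (A) $W=S_n$, $n\ge1$: for each $0\le k\le\lfloor n/2\rfloor$, $J=\{s_1,\dots,s_{n-1}\}\setminus\{s_{2k}\}$ (so $W_J=S_{2k}\times S_{n-2k}$ with $S_{n-2k}=\langle s_{2k+1},\dots,s_{n-1}\rangle$), $z_{\min}=s_1s_3\cdots s_{2k-1}$,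 $\sigma=\mathbb 1_{S_{2k}}\times\mathrm{sgn}_{S_{n-2k}}$. (BC) $W=W^{\mathsf{BC}}_n$, $n\ge2$: for each $0\le k\le\lfloor n/2\rfloor$, $J=\{s_0,\dots,s_{n-1}\}\setminus\{s_{2k}\}$ (so $W_J=W^{\mathsf{BC}}_{2k}\times S_{n-2k}$), $z_{\min}=s_1s_3\cdots s_{2k-1}$, $\sigma=\mathbb 1_{W^{\mathsf{BC}}_{2k}}\times\mathrm{sgn}_{S_{n-2k}}$. (D) $W=W^{\mathsf D}_n$, $n\ge3$: for each $0<k\le\lfloor n/2\rfloor$, $J=\{s_{-1},s_1,\dots,s_{n-1}\}\setminus\{s_{2k}\}$ (so $W_J=W^{\mathsf D}_{2k}\times S_{n-2k}$), $z_{\min}=s_1s_3\cdots s_{2k-1}$, $\sigma=\mathbb 1_{W^{\mathsf D}_{2k}}\times\mathrm{sgn}_{S_{n-2k}}$; plus the triple $(\{s_1,\dots,s_{n-1}\},1,\mathrm{sgn}_{S_n})$. *)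

(* Defs.v *)
From HB Require Import structures.
From mathcomp Require Import all_boot all_order all_algebra all_fingroup all_field all_character.
Set Implicit Arguments. Unset Strict Implicit. Unset Printing Implicit Defensive.
Import GRing.Theory.

Local Open Scope group_scope.

(* Signed permutations.  The point +(p+1) of {±1,...,±n} is encoded as        *)
(* (p, false) and -(p+1) as (p, true), for p : 'I_n.                          *)
Definition Tn (n : nat) := ('I_n * bool)%type.

Definition negT n (x : Tn n) : Tn n := (x.1, ~~ x.2).

Definition tp n (a b : nat * bool) : {perm Tn n} :=
  match (insub a.1 : option 'I_n), (insub b.1 : option 'I_n) with
  | Some i, Some j => tperm (i, a.2) (j, b.2)
  | _, _ => 1
  end.

(* s_i = (i,i+1)(-i,-i-1) for i >= 1 *)
Definition sA n (i : nat) : {perm Tn n} :=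
  tp n (i.-1, false) (i, false) * tp n (i.-1, true) (i, true).
Definition s0 n : {perm Tn n} := tp n (0%N, false) (0%N, true).
Definition sm1 n : {perm Tn n} := tp n (0%N, false) (1%N, true) * tp n (0%N, true) (1%N, false).

Definition genBC n (i : nat) : {perm Tn n} := if i == 0 then s0 n else sA n i.
Definition genD n (i : nat) : {perm Tn n} := if i == 0 then sm1 n else sA n i.

Definition SA n : {set {perm Tn n}} := [set sA n i | i : 'I_n & 0 < i].
Definition SBC n : {set {perm Tn n}} := [set genBC n i | i : 'I_n].
Definition SD n : {set {perm Tn n}} := [set genD n i | i : 'I_n].

Definition BCset n : {set {perm Tn n}} :=
  [set w : {perm Tn n} | [forall x, w (negT x) == negT (w x)]].

Lemma BCset_group n : group_set (BCset n).
Proof.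
apply/group_setP; split.
  by rewrite inE; apply/forallP => x; rewrite !perm1.
move=> v w; rewrite !inE => /forallP Hv /forallP Hw; apply/forallP => x.
by rewrite !permM (eqP (Hv x)) (eqP (Hw (v x))).
Qed.
Canonical WBC n : {group {perm Tn n}} := Group (BCset_group n).

Definition nsign n (w : {perm Tn n}) : bool :=
  \big[addb/false]_(i : 'I_n) (w (i, false)).2.

Lemma nsignM n (v w : {perm Tn n}) : v \in BCset n -> w \in BCset n ->
  nsign (v * w) = nsign v (+) nsign w.
Proof.
rewrite !inE => /forallP Hv /forallP Hw.
have step i : ((v * w) (i, false)).2 =
    (v (i, false)).2 (+) (w ((v (i, false)).1, false)).2.
  rewrite permM; case: (v (i, false)) => j [] //=.
  have -> : ((j, true) : Tn n) = negT (j, false) by [].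
  by rewrite (eqP (Hw _)) /=; case: (w (j, false)) => ? [].
rewrite /nsign (eq_bigr _ (fun i _ => step i)) big_split /=; congr addb.
have inj : injective (fun i : 'I_n => (v (i, false)).1).
  move=> i i' /= eq1.
  have : v (i, false) = v (i', false) \/ v (i, false) = v (i', true).
    have -> : ((i', true) : Tn n) = negT (i', false) by [].
    rewrite (eqP (Hv _)); case: (v (i, false)) eq1 => a b;
      case: (v (i', false)) => a' b' /= ->; case: b; case: b'; by [left|right].
  by case=> /perm_inj [->].
by rewrite [RHS](reindex_inj inj).
Qed.

Definition Dset n : {set {perm Tn n}} := [set w in BCset n | ~~ nsign w].

Lemma Dset_group n : group_set (Dset n).
Proof.
apply/group_setP; split.
  rewrite in_set (group1 (WBC n)) /= /nsign big1 // => i _; by rewrite perm1.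
move=> v w /setIdP [Hv Nv] /setIdP [Hw Nw]; apply/setIdP; split.
  exact: (groupM (G := WBC n) Hv Hw).
by rewrite nsignM // (negbTE Nv) (negbTE Nw).
Qed.
Canonical WD n : {group {perm Tn n}} := Group (Dset_group n).

Definition WA n : {group {perm Tn n}} := <<SA n>>%G.

Section Generic.
Variable gT : finGroupType.
Implicit Types (S J : {set gT}) (z w : gT).

Definition clen S w : nat :=
  find (fun k => w \in iter k (fun B => B :|: B * S) [set 1]) (iota 0 #|gT|.+1).

Definition refl J : {set gT} := [set s ^ w | s in J, w in <<J>>].

(* z (i.e. the pair (z, id) of W_J^+) is a perfect involution of (W_J, J) *)
Definition perfect_inv J z : bool :=
  [&& z \in <<J>>, z * z == 1 & [forall t in refl J, (z * t) ^+ 4 == 1]].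

(* (z, id) is W_J-minimal, the length being the restriction of that of (W,S) *)
Definition WJ_minimal S J z : bool :=
  [forall s in J, clen S z <= clen S (s * z * s)].

Definition sign_hom J (sigma : gT -> algC) : Prop :=
  (forall x, x \in <<J>> -> sigma x = 1%R \/ sigma x = (-1)%R) /\
  (forall x y, x \in <<J>> -> y \in <<J>> -> sigma (x * y)%g = (sigma x * sigma y)%R).

(* the class function of G agreeing with f on G (0 if this is not a class   *)
(* function of G)                                                            *)
Definition cf_of (G : {group gT}) (f : gT -> algC) : 'CF(G) :=
  insubd (0%R : 'CF(G)) [ffun x => if x \in G then f x else 0%R].

Definition model_triple S J z (sigma : gT -> algC) : Prop :=
  [/\ J \subset S, perfect_inv J z, WJ_minimal S J z & sign_hom J sigma].

Definition triple_char (W : {group gT}) J z (sigma : gT -> algC) : 'CF(W) :=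
  ('Ind[W, 'C_(<<J>>)[z]] ('Res['C_(<<J>>)[z], <<J>>] (cf_of <<J>>%G sigma)))%R.

Definition perfect_model (W : {group gT}) S
    (P : seq ({set gT} * gT * (gT -> algC))) : Prop :=
  (forall i : 'I_(size P),
     let t := tnth (in_tuple P) i in model_triple S t.1.1 t.1.2 t.2) /\
  (\sum_(t <- P) triple_char W t.1.1 t.1.2 t.2 = \sum_(i < Nirr W) 'chi[W]_i)%R.

End Generic.

Definition zmin n k : {perm Tn n} := \prod_(i < k) sA n (2 * i + 1)%N.

(* sigma = 1 x sgn on W_{2k} x S_{n-2k}: for w in W_J, (-1)^(number of       *)
(* inversions of w among the points 2k+1, ..., n), i.e. the sign of the      *)
(* component of w in S_{n-2k} = <s_{2k+1}, ..., s_{n-1}>.                     *)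
Definition sigmaQ n (p : nat) (w : {perm Tn n}) : algC :=
  ((-1) ^+ #|[set ij : 'I_n * 'I_n |
      [&& (p <= ij.1)%N, (ij.1 < ij.2)%N & ((w (ij.2, false)).1 < (w (ij.1, false)).1)%N]]|)%R.

Arguments sigmaQ : clear implicits.

Definition PA m : seq ({set {perm Tn m}} * {perm Tn m} * ({perm Tn m} -> algC)) :=
  [seq ([set sA m i | i : 'I_m & (0 < i) && (val i != (2 * k)%N)], zmin m k, sigmaQ m (2 * k)%N)
  | k <- iota 0 (m./2).+1].

Definition PBC n : seq ({set {perm Tn n}} * {perm Tn n} * ({perm Tn n} -> algC)) :=
  [seq ([set genBC n i | i : 'I_n & val i != (2 * k)%N], zmin n k, sigmaQ n (2 * k)%N)
  | k <- iota 0 (n./2).+1].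

Definition PD n : seq ({set {perm Tn n}} * {perm Tn n} * ({perm Tn n} -> algC)) :=
  ([set genD n i | i : 'I_n & val i != 0%N], 1%g, sigmaQ n 0) ::
  [seq ([set genD n i | i : 'I_n & val i != (2 * k)%N], zmin n k, sigmaQ n (2 * k)%N)
  | k <- iota 1 (n./2)].

(* Main.v *)
Require Import Defs.
From mathcomp Require Import all_boot all_order all_algebra all_fingroup all_field all_character.
From mathcomp Require Import zify.

(* Let [R g] be the number of square roots of [g].  If every element of a finite
   group is conjugate to its inverse, then the Frobenius-Schur indicators are all
   [1] or [-1]; so if moreover [R] is a genuine character, it is the sum of all the
   irreducible ones.  It remains to show that the model character [M] equals [R].

   A coset of the centralizer of [zmin] in [<<J>>] is a pair [(tau, P)]: an
   involution [tau] without fixed indices on part of the signed points, and a choice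
   [P] of one point in each remaining pair [{x, -x}].  Such a pair is encoded by the
   function [f] equal to [tau] on the first part and to the projection onto [P] on
   the second; [w] fixes the coset iff [f] commutes with [w], so [M g] is the sum,
   over the [f] commuting with [g], of the sign of [g] on the fixed points of [f].
   This sum is compared with [R g] by removing the orbits of [<g, -1>] one or two at
   a time.  When [f] exchanges two orbits, [f] corresponds to a square root of [g];
   on a stable orbit made of two [g]-cycles of even length the involutions cancel the
   projections, while for odd length the projections correspond to square roots.

   In type D with [n] odd, [W^BC_n] is the direct product of [W^D_n] and [{1, -1}],
   so that both [M] and [R] for [W^D_n] are half of those for [W^BC_n]. *)

Set Implicit Arguments. Unset Strict Implicit. Unset Printing Implicit Defensive.
Import GRing.Theory Num.Theory.
Local Open Scope group_scope.

(** * Frobenius-Schur indicators *)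

(** Types A and BC are one computation. The symmetric group sits inside the signed permutations as
    the stabilizer of the set [U] of positive points, while in type BC [U] is everything. Requiring
    [f] to preserve [U] makes tau unsigned in type A and forces P to consist of positive points. The
    index [k] of a triple is half the number of indices moved by [f]. Fixing it would couple the
    orbits; summing over all triples leaves one sum over all [f], which factors over the unions of
    orbits preserved by [f]. This is why the whole model can be compared with the square roots orbit
    by orbit. No representation is shown to be real. The indicators are only known to have square 1,
    and the value 1 comes out because they are multiplicities in [M], which is a character by
    construction. *)

Section FrobeniusSchur.
Variables (gT : finGroupType) (G : {group gT}).

(** Schur's lemma: the sum of the matrices [rho (b ^ y)] commutes with [rho], hence is a scalar [c],
    and comparing traces gives [c]. *)
Lemma irr_mul_class_sum (i : Iirr G) a b : a \in G -> b \in G ->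
  (\sum_(y in G) 'chi_i (a * b ^ y)%g * 'chi_i 1%g = #|G|%:R * 'chi_i a * 'chi_i b)%R.
Proof.
move=> Ga Gb; have [rG irrG def_chi] := irr_reprP (mem_irr i).
set rho := rG in irrG def_chi *.
have chiE x : x \in G -> ('chi_i x = \tr (rho x))%R.
  by move=> Gx; rewrite def_chi cfunE Gx mulr1n.
pose B := (\sum_(y in G) rho (b ^ y)%g)%R.
have /is_scalar_mxP[c defB]: is_scalar_mx B.
  apply: (@mx_abs_irr_cent_scalar _ _ _ _ rho); first exact/groupC.
  apply/centgmxP=> x Gx; rewrite /B mulmx_suml mulmx_sumr.
  rewrite [RHS](reindex_acts 'R _ Gx) ?astabsR //=; apply: eq_bigr => y Gy.
  rewrite -!repr_mxM ?memJ_norm ?(subsetP (normG G)) ?groupM ?groupJ //.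
  by rewrite conjgM (conjgE _ x) mulKVg.
have trB: (c * 'chi_i 1%g = #|G|%:R * 'chi_i b)%R.
  rewrite [in LHS]chiE ?group1 // repr_mx1 -mxtraceZ scalemx1 -defB /B.
  rewrite raddf_sum /= (eq_bigr (fun _ => 'chi_i b)%R) ?sumr_const ?mulr_natl //.
  by move=> y Gy; rewrite -chiE ?groupJ // cfunJ.
rewrite -mulr_suml.
have ->: (\sum_(y in G) 'chi_i (a * b ^ y)%g = c * 'chi_i a)%R.
  rewrite (eq_bigr (fun y => \tr (rho a *m rho (b ^ y)%g))%R); last first.
    by move=> y Gy; rewrite -repr_mxM ?groupJ // -chiE // groupM ?groupJ.
  by rewrite -raddf_sum -mulmx_sumr -/B defB mul_mx_scalar /= mxtraceZ chiE.
by rewrite mulrAC trB mulrAC.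
Qed.

Hypothesis G_real : forall x, x \in G -> exists2 y, y \in G & x ^ y = x^-1.

Lemma irr_inv_real (i : Iirr G) x : x \in G -> ('chi_i x^-1%g = 'chi_i x)%R.
Proof. by move=> Gx; have [y Gy <-] := G_real Gx; rewrite cfunJ. Qed.

(* Both evaluations of [\sum_(x, y) chi (x^2 y^2)] are compared: averaging over
   conjugates of [x], and substituting [a = x y], which turns [x^2 y^2] into
   [a (a ^ y)]. *)
Lemma sum_irr_sq (i : Iirr G) :
  ((\sum_(x in G) 'chi_i (x * x)%g) ^+ 2 = #|G|%:R ^+ 2)%R.
Proof.
set chi := ('chi_i)%R; set N := (\sum_(x in G) _)%R.
have GC0: (#|G|%:R != 0 :> algC)%R by rewrite pnatr_eq0 -lt0n cardG_gt0.
have chi1: (chi 1%g != 0)%R by exact: irr1_neq0.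
pose D := (\sum_(x in G) \sum_(y in G) chi (x * x * (y * y))%g)%R.
have way1: (#|G|%:R * D * chi 1%g = #|G|%:R * N ^+ 2)%R.
  have DE u : u \in G -> D = (\sum_(x in G) \sum_(y in G) chi (x * x * (y * y) ^ u)%g)%R.
    move=> Gu; apply: eq_bigr => x Gx; rewrite (reindex_acts 'J _ Gu) ?astabsJ ?(subsetP (normG G)) //=.
    by apply: eq_bigr => y Gy; rewrite -conjMg.
  have ->: (#|G|%:R * D = \sum_(u in G) D)%R by rewrite sumr_const mulr_natl.
  rewrite (eq_bigr _ DE) exchange_big /= mulr_suml.
  rewrite (eq_bigr (fun x => #|G|%:R * chi (x * x)%g * N)%R); last first.
    move=> x Gx; rewrite exchange_big mulr_suml /N mulr_sumr; apply: eq_bigr => y Gy.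
    by rewrite mulr_suml irr_mul_class_sum ?groupM.
  by rewrite -mulr_suml -mulr_sumr expr2 mulrA.
have way2: (D * chi 1%g = #|G|%:R ^+ 2)%R.
  have ->: D = (\sum_(y in G) \sum_(a in G) chi (a * a ^ y)%g)%R.
    rewrite /D exchange_big /=; apply: eq_bigr => y Gy.
    rewrite [RHS](reindex_acts 'R _ Gy) ?astabsR //=; apply: eq_bigr => x Gx.
    by congr (chi _); rewrite conjgE !mulgA mulgK.
  rewrite exchange_big mulr_suml /=.
  rewrite (eq_bigr (fun a => #|G|%:R * (chi a * (chi a)^*))%R); last first.
    move=> a Ga; rewrite mulr_suml irr_mul_class_sum // -mulrA; congr (_ * (_ * _))%R.
    by rewrite -irr_inv irr_inv_real.
  rewrite -mulr_sumr expr2; congr (_ * _)%R.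
  have := cfnorm_irr i; rewrite cfdotE => /(canRL (mulVKf _)) -> //; first by rewrite mulr1.
by apply: (mulfI GC0); rewrite -way1 -mulrA way2.
Qed.

Theorem sum_irr_of_sqrt_count (M : 'CF(G)) : M \is a character ->
  (forall g, g \in G -> M g = #|[set x in G | (x * x)%g == g]|%:R)%R ->
  (M = \sum_i 'chi_i)%R.
Proof.
move=> charM ME; rewrite [LHS]cfun_sum_cfdot; apply: eq_bigr => i _.
suff ->: ('[M, 'chi_i] = 1)%R by rewrite scale1r.
have GC0: (#|G|%:R != 0 :> algC)%R by rewrite pnatr_eq0 -lt0n cardG_gt0.
set nu := '[_, _]%R.
(* The multiplicity is the Frobenius-Schur indicator, once the [x] are grouped by their squares;
   reality of [G] removes the complex conjugation of the inner product. *)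
have nuE: (nu = #|G|%:R^-1 * \sum_(x in G) 'chi_i (x * x)%g)%R.
  rewrite /nu cfdotE; congr (_ * _)%R.
  rewrite [RHS](partition_big (fun x => x * x) (mem G)) /=; last by move=> x Gx; rewrite groupM.
  apply: eq_bigr => g Gg; rewrite ME // -irr_inv irr_inv_real // mulr_natl -sumr_const.
  by apply: eq_big => [x|x]; rewrite inE // => /andP[_ /eqP->].
(* A multiplicity in a character is a natural number, which rules out the value [-1]. *)
have /natrP[n defn]: nu \in Num.nat by exact: Cnat_cfdot_char_irr.
have: (nu ^+ 2 = 1)%R by rewrite nuE exprMn sum_irr_sq -exprMn mulVf ?expr1n.
rewrite defn -natrX => /eqP; rewrite -[X in _ == X]/(1%:R)%R eqr_nat.
by rewrite -(exp1n 2) eqn_sqr => /eqP->.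
Qed.

End FrobeniusSchur.

(** * Signed count of the functions commuting with a permutation *)

Section PartialSolutions.
Variables (X : finType) (neg : X -> X) (g : {perm X}) (U : {set X}).
Hypothesis negK : involutive neg.
Hypothesis neg_neq : forall x, neg x != x.
Hypothesis gneg : forall x, g (neg x) = neg (g x).
Hypothesis gU : forall x, (g x \in U) = (x \in U).
(** With the next hypothesis: [U] is either everything (type BC) or contains exactly one of each
    [x], [neg x] (type A). *)
Hypothesis Ucov : forall x, (x \in U) || (neg x \in U).
Hypothesis UnegT : forall x y, x \in U -> neg x \in U -> y \in U.
Implicit Types (Z B : {set X}) (f h k : {ffun X -> X}) (c : bool).

Definition pm x y := (y == x) || (y == neg x).

(* For [c = true], [f] is a square root of [g]; for [c = false], it is the function
   attached to a pair [(tau, P)], commuting with [g]. *)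
Definition sol_at c f x :=
  [&& f (g x) == g (f x), (x \in U) ==> (f x \in U) &
   if c then (f (f x) == g x) && (f (neg x) == neg (f x)) else
   if pm x (f x) then f (neg x) == f x
   else (f (f x) == x) && (f (neg x) == neg (f x))].

(** Pinning the value outside [Z] to the identity makes a solution determined by its restriction to
    [Z], so that [restr] and [glue] can be mutually inverse. *)
Definition sol c Z : {set {ffun X -> X}} :=
  [set f : {ffun X -> X} | [forall x, if x \in Z then (f x \in Z) && sol_at c f x else f x == x]].

Definition restr B f : {ffun X -> X} := [ffun x => if x \in B then f x else x].
Definition glue B h k : {ffun X -> X} := [ffun x => if x \in B then h x else k x].
Definition fixin f Z := [set x in Z | f x == x].

Lemma mem_fixin f Z x : (x \in fixin f Z) = (x \in Z) && (f x == x).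
Proof. by rewrite inE. Qed.

Definition stable Z := forall x, ((g x \in Z) = (x \in Z)) * ((neg x \in Z) = (x \in Z)).
Definition invar B f := [forall x in B, f x \in B].

Lemma sol_memP c Z f :
  reflect ((forall x, x \in Z -> f x \in Z /\ sol_at c f x) /\ (forall x, x \notin Z -> f x = x))
    (f \in sol c Z).
Proof.
rewrite inE; apply: (iffP forallP) => [H|[H1 H2] x].
  by split=> x xZ; have:= H x; [rewrite xZ => /andP | rewrite (negbTE xZ) => /eqP].
by case: ifPn => [/H1[-> ->]|/H2->].
Qed.

Lemma stableD Z B : stable Z -> stable B -> stable (Z :\: B).
Proof. by move=> sZ sB x; rewrite !inE !sZ !sB. Qed.

Lemma stableU Z B : stable Z -> stable B -> stable (Z :|: B).
Proof. by move=> sZ sB x; rewrite !inE !sZ !sB. Qed.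

Lemma sol_at_local c B f h x : stable B -> {in B, f =1 h} -> invar B f -> x \in B ->
  sol_at c f x = sol_at c h x.
Proof.
move=> sB fh /forall_inP fB xB.
by rewrite /sol_at -!fh ?sB ?fB.
Qed.

(** [f] need not be injective, but [f x] determines [x] up to [g] and [neg]: either [f (f x)] is [x]
    or [g x], or [f x] is [x] or [neg x]. This makes the complement of [B] invariant. *)
Lemma sol_preim c Z B f x : stable B -> f \in sol c Z -> invar B f ->
  x \in Z -> f x \in B -> x \in B.
Proof.
move=> sB /sol_memP[H _] /forall_inP fB xZ fxB; have [_ /and3P[_ _]] := H x xZ.
case: c {H} => [/andP[/eqP ffx _]|]; first by rewrite -sB -ffx fB.
case: ifP => [/orP[]/eqP E _|_ /andP[/eqP ffx _]]; last by rewrite -ffx fB.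
  by rewrite -E.
by move: fxB; rewrite E sB.
Qed.

Lemma sol_restr c Z B f : stable B -> B \subset Z -> f \in sol c Z -> invar B f ->
  restr B f \in sol c B.
Proof.
move=> sB sBZ fS fB; have /sol_memP[H _] := fS; apply/sol_memP; split=> x xB; last first.
  by rewrite ffunE (negbTE xB).
have E: {in B, f =1 restr B f} by move=> y yB; rewrite ffunE yB.
rewrite -(sol_at_local _ sB E) // -E // (forall_inP fB) //; split=> //.
by have [] := H x (subsetP sBZ _ xB).
Qed.

Lemma invar_compl c Z B f : stable B -> f \in sol c Z -> invar B f -> invar (Z :\: B) f.
Proof.
move=> sB fS fB; apply/forall_inP=> x /setDP[xZ xB]; rewrite inE.
have /sol_memP[H _] := fS; have [-> _] := H x xZ; rewrite andbT.
by apply: contra xB; apply: sol_preim fS fB xZ.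
Qed.

Lemma sol_glue c Z B h k : stable B -> stable Z -> B \subset Z ->
  h \in sol c B -> k \in sol c (Z :\: B) -> glue B h k \in sol c Z.
Proof.
move=> sB sZ sBZ /sol_memP[Hh _] /sol_memP[Hk Hk']; apply/sol_memP; split=> x xZ; last first.
  have xB : x \notin B by apply: contra xZ; apply: (subsetP sBZ).
  by rewrite ffunE (negbTE xB) Hk' // inE (negbTE xZ) andbF.
have Eh: {in B, h =1 glue B h k} by move=> y yB; rewrite ffunE yB.
have Ek: {in Z :\: B, k =1 glue B h k}.
  by move=> y /setDP[_ yB]; rewrite ffunE (negbTE yB).
have [xB|xB] := boolP (x \in B).
  have [hxB hat] := Hh x xB; split; first by rewrite -Eh // (subsetP sBZ).
  by rewrite -(sol_at_local _ sB Eh) //; apply/forall_inP=> y /Hh[].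
have xD : x \in Z :\: B by rewrite inE xB.
have [kxB kat] := Hk x xD; split; first by rewrite -Ek //; case/setDP: kxB.
by rewrite -(sol_at_local _ (stableD sZ sB) Ek) //; apply/forall_inP=> y /Hk[].
Qed.

(** Restricting to [B] and to its complement, with inverse [glue], identifies the functions
    preserving [B] with pairs of independent solutions. The predicate [P] is there for the condition
    [f r = u] on two exchanged orbits. *)
Lemma sol_split (R : comNzRingType) c Z B (P : pred {ffun X -> X}) (F1 F2 : {ffun X -> X} -> R) :
  stable B -> stable Z -> B \subset Z ->
  (\sum_(f in sol c Z | invar B f && P (restr B f)) F1 (restr B f) * F2 (restr (Z :\: B) f) =
   (\sum_(h in sol c B | P h) F1 h) * (\sum_(k in sol c (Z :\: B)) F2 k))%R.
Proof.
move=> sB sZ sBZ; rewrite big_distrlr /= pair_big /=.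
rewrite [RHS](reindex_onto (fun f => (restr B f, restr (Z :\: B) f))
                           (fun p => glue B p.1 p.2)) /=; last first.
  case=> h k /= /andP[/andP[/sol_memP[_ Hh'] _] /sol_memP[_ Hk']].
  congr pair; apply/ffunP=> x; rewrite !ffunE.
    by case: (boolP (x \in B)) => // /Hh'->.
  by case: ifPn => [/setDP[_ /negbTE->] | /Hk'->].
apply: eq_bigl => f; apply/andP/andP => [[fS /andP[fB Pf]]|].
  split; first rewrite Pf andbT (sol_restr sB sBZ) //=.
    by apply: (sol_restr (stableD sZ sB) _ fS (invar_compl sB fS fB)); apply: subsetDl.
  apply/eqP/ffunP=> x; rewrite !ffunE !inE; case: (x \in B) => //=; case: ifP => //= xZ.
  by have /sol_memP[_ ->] := fS; rewrite ?xZ.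
case=> /andP[/andP[hS ->] kS] /eqP Ef; split; first by rewrite -Ef sol_glue.
rewrite andbT; apply/forall_inP=> x xB; have /sol_memP[/(_ x xB)[]] := hS.
by rewrite ffunE xB.
Qed.

(** * Orbits of the group generated by [g] and [neg] *)

Definition orb x := porbit g x :|: porbit g (neg x).

Lemma expg_neg i x : (g ^+ i) (neg x) = neg ((g ^+ i) x).
Proof. by elim: i x => [|i IHi] x; rewrite ?expg0 ?perm1 // expgS !permM gneg IHi. Qed.

Lemma mem_porbit_neg x y : (neg x \in porbit g (neg y)) = (x \in porbit g y).
Proof.
apply/porbitP/porbitP=> -[i E]; exists i; last by rewrite E expg_neg.
by apply: (can_inj negK); rewrite -expg_neg.
Qed.

Lemma mem_porbit_perm x y : (g x \in porbit g y) = (x \in porbit g y).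
Proof. by rewrite -!eq_porbit_mem -(expg1 g) porbit_perm. Qed.

Lemma orb_id x : x \in orb x. Proof. by rewrite inE porbit_id. Qed.

Lemma orb_stable x : stable (orb x).
Proof.
move=> y; rewrite !inE !mem_porbit_perm mem_porbit_neg; split=> //.
by rewrite orbC -{2}[x]negK mem_porbit_neg.
Qed.

Lemma orb_ind (P : pred X) r : P r -> (forall x, x \in orb r -> P x -> P (g x)) ->
  (forall x, x \in orb r -> P x -> P (neg x)) -> {in orb r, forall x, P x}.
Proof.
move=> Pr Pg Pn; have H i : P ((g ^+ i) r).
  elim: i => [|i IHi]; first by rewrite expg0 perm1.
  by rewrite expgSr permM; apply: Pg => //; rewrite inE mem_porbit.
move=> x; rewrite inE => /orP[]/porbitP[i ->] //.
by rewrite expg_neg; apply: Pn => //; rewrite inE mem_porbit.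
Qed.

Lemma orb_sub r Z : stable Z -> r \in Z -> orb r \subset Z.
Proof. by move=> sZ rZ; apply/subsetP; apply: orb_ind => // x _; rewrite sZ. Qed.

Lemma orb_disj r u x : u \notin orb r -> x \in orb u -> x \notin orb r.
Proof.
move=> ur xu; apply: (orb_ind (P := fun x => x \notin orb r)) xu => // y _.
  by rewrite orb_stable.
by rewrite orb_stable.
Qed.

Lemma pm_orb x Z : stable Z -> forall y, pm x y -> (y \in Z) = (x \in Z).
Proof. by move=> sZ y /orP[]/eqP->; rewrite ?sZ. Qed.

Lemma solG c Z f x : f \in sol c Z -> x \in Z -> f (g x) = g (f x).
Proof. by move=> /sol_memP[H _] /H[_ /and3P[/eqP]]. Qed.

Lemma solU c Z f x : f \in sol c Z -> x \in Z -> x \in U -> f x \in U.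
Proof. by move=> /sol_memP[H _] /H[_ /and3P[_ /implyP]]. Qed.

Lemma solZ c Z f x : f \in sol c Z -> (f x \in Z) = (x \in Z).
Proof.
move=> /sol_memP[H1 H2]; have [/H1[] //|xZ] := boolP (x \in Z).
by rewrite H2 // (negbTE xZ).
Qed.

Lemma sol_out c Z f x : f \in sol c Z -> x \notin Z -> f x = x.
Proof. by move=> /sol_memP[_]; apply. Qed.

Lemma sol_neg c Z f x : f \in sol c Z -> x \in Z -> c || ~~ pm x (f x) ->
  f (neg x) = neg (f x).
Proof.
move=> /sol_memP[H _] /H[_ /and3P[_ _]]; case: c {H} => [/andP[_ /eqP] //|] /=.
by case: ifP => // _ /andP[_ /eqP].
Qed.

Lemma sol_neg_pm c Z f x : f \in sol c Z -> x \in Z -> pm (f x) (f (neg x)).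
Proof.
move=> fS xZ; have [cf|] := boolP (c || ~~ pm x (f x)).
  by rewrite (sol_neg fS xZ cf) /pm eqxx orbT.
rewrite negb_or negbK => /andP[/negbTE c0 pf]; move: fS; rewrite c0 => /sol_memP[H _].
by have [_ /and3P[_ _]] := H x xZ; rewrite pf => /eqP->; rewrite /pm eqxx.
Qed.

Lemma sol_sq c Z f x : f \in sol c Z -> x \in Z -> c || ~~ pm x (f x) ->
  f (f x) = if c then g x else x.
Proof.
move=> /sol_memP[H _] /H[_ /and3P[_ _]]; case: c {H} => [/andP[/eqP] //|] /=.
by case: ifP => // _ /andP[/eqP].
Qed.

Lemma sol_pm Z f x : f \in sol false Z -> x \in Z -> pm x (f x) -> f (neg x) = f x.
Proof. by move=> /sol_memP[H _] /H[_ /and3P[_ _]] /[swap] ->  /eqP. Qed.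

Lemma sol_expg c Z f x i : stable Z -> f \in sol c Z -> x \in Z ->
  f ((g ^+ i) x) = (g ^+ i) (f x).
Proof.
move=> sZ fS xZ; elim: i => [|i IHi]; first by rewrite expg0 !perm1.
have gZ : (g ^+ i) x \in Z.
  by elim: i {IHi} => [|i IHi]; rewrite ?expg0 ?perm1 // expgSr permM sZ.
by rewrite expgSr !permM (solG fS gZ) IHi.
Qed.

Lemma sol_invar c Z f r : stable Z -> r \in Z -> f \in sol c Z -> f r \in orb r -> invar (orb r) f.
Proof.
move=> sZ rZ fS frY; apply/forall_inP; apply: orb_ind => // x xY fxY;
  have xZ := subsetP (orb_sub sZ rZ) _ xY.
  by rewrite (solG fS) ?orb_stable.
by rewrite (pm_orb (orb_stable r) (sol_neg_pm fS xZ)).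
Qed.

(** Leaving the orbit excludes the projection case at [r], so [f (f r)] is [r] or [g r] and lies in
    the orbit again; commutation with [g] and [neg] spreads this to all points. *)
Lemma sol_swap c Z f r : stable Z -> r \in Z -> f \in sol c Z -> f r \notin orb r ->
  {in orb r, forall x, f x \in orb (f r)} * {in orb (f r), forall x, f x \in orb r}.
Proof.
move=> sZ rZ fS frY; have uZ : f r \in Z by rewrite (solZ _ fS).
split; apply: orb_ind => [|x xY fxY|x xY fxY]; rewrite ?orb_id //.
- by rewrite (solG fS) ?orb_stable // (subsetP (orb_sub sZ rZ)).
- by rewrite (pm_orb (orb_stable _) (sol_neg_pm fS (subsetP (orb_sub sZ rZ) _ xY))).
- have nP: ~~ pm r (f r).
    by apply: contra frY => /(pm_orb (orb_stable r))->; rewrite orb_id.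
  by rewrite (sol_sq fS) ?nP ?orbT //; case: (c); rewrite ?orb_stable orb_id.
- by rewrite (solG fS) ?orb_stable // (subsetP (orb_sub sZ uZ)).
by rewrite (pm_orb (orb_stable _) (sol_neg_pm fS (subsetP (orb_sub sZ uZ) _ xY))).
Qed.

(* A permutation of [Q] with [c] cycles has sign [(-1) ^ (#|Q| - c)]. *)
Definition sg (Q : {set X}) : algC := ((-1) ^+ (#|Q| + #|porbit g @: Q|))%R.

Lemma sg0 : sg set0 = 1%R.
Proof. by rewrite /sg imset0 !cards0 expr0. Qed.

Lemma sgU B (Q Q' : {set X}) : (forall x, (g x \in B) = (x \in B)) -> Q \subset B -> [disjoint Q' & B] ->
  sg (Q :|: Q') = (sg Q * sg Q')%R.
Proof.
move=> gB QB Q'B; have dQ : [disjoint Q & Q'].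
  by rewrite disjoint_sym; apply: disjointWr QB Q'B.
rewrite /sg imsetU !cardsU; move: dQ; rewrite -setI_eq0 => /eqP->; rewrite cards0 subn0.
suff ->: porbit g @: Q :&: porbit g @: Q' = set0.
  by rewrite cards0 subn0 addnACA exprD.
apply/eqP; rewrite setI_eq0; apply/pred0P=> O /=; apply/negP=> /andP[/imsetP[x xQ ->]].
case/imsetP=> y yQ' /esym/eqP; rewrite eq_porbit_mem => /porbitP[i Ey].
have yB : y \in B.
  rewrite Ey; elim: i {Ey} => [|i IHi]; first by rewrite expg0 perm1 (subsetP QB).
  by rewrite expgSr permM gB.
by rewrite (disjointFr Q'B yQ') in yB.
Qed.

Lemma sg_porbit x : sg (porbit g x) = ((-1) ^+ #|porbit g x|.+1)%R.
Proof.
rewrite /sg (_ : porbit g @: _ = [set porbit g x]) ?cards1 ?addn1 //.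
apply/setP=> O; rewrite inE; apply/imsetP/eqP=> [[y yx ->]|->]; last by exists x; rewrite ?porbit_id.
by apply/eqP; rewrite eq_porbit_mem.
Qed.

Lemma sg_restr Z B f : stable B -> B \subset Z ->
  sg (fixin f Z) = (sg (fixin (restr B f) B) * sg (fixin (restr (Z :\: B) f) (Z :\: B)))%R.
Proof.
move=> sB BZ; rewrite -(@sgU B) //.
- congr sg; apply/setP=> x; rewrite !inE !ffunE !inE.
  by have:= subsetP BZ x; case: (x \in B) => [/(_ isT)->|_] /=; rewrite ?orbF //; case: (x \in Z).
- by move=> x; rewrite sB.
- by apply/subsetP=> x; rewrite inE => /andP[].
by apply/pred0P=> x /=; rewrite !inE; case: (x \in B); rewrite ?andbF.
Qed.

(** * Two exchanged orbits *)

Definition gstep c : {perm X} := if c then g^-1 else g.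

Definition twist w u h : {ffun X -> X} := [ffun x => if x \in orb u then (w : {perm X}) (h x) else h x].

Lemma gstep_neg c x : gstep c (neg x) = neg (gstep c x).
Proof. by case: c => /=; rewrite ?gneg //; apply: (@perm_inj _ g); rewrite gneg !permKV. Qed.

Lemma gstep_g c x : gstep c (g x) = g (gstep c x).
Proof. by case: c => //=; rewrite permK permKV. Qed.

Lemma gstep_mem c Z x : stable Z -> (gstep c x \in Z) = (x \in Z).
Proof. by move=> sZ; case: c => /=; rewrite ?sZ // -[in RHS](permKV g x) sZ. Qed.

Lemma gstep_U c x : (gstep c x \in U) = (x \in U).
Proof. by case: c => /=; rewrite ?gU // -[in RHS](permKV g x) gU. Qed.

(* On two orbits exchanged by [h], composing [h] with [g] on one of them turns an
   involution into a square root of [g], and conversely with the inverse of [g]. *)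
Lemma twist_sol c r u h : u \notin orb r -> h \in sol c (orb r :|: orb u) -> h r = u ->
  twist (gstep c) u h \in sol (~~ c) (orb r :|: orb u) /\ twist (gstep c) u h r = u.
Proof.
move=> ur hS hr; set B := orb r :|: orb u in hS *.
have sB : stable B by apply: stableU; apply: orb_stable.
have rB : r \in B by rewrite /B in_setU orb_id.
have [] := sol_swap sB rB hS; rewrite hr // => Hr Hu.
have dis := orb_disj ur.
have Br x : x \in orb r -> x \in B by move=> xr; rewrite /B in_setU xr.
have Bu x : x \in orb u -> x \in B by move=> xr; rewrite /B in_setU xr orbT.
have nu x : x \in orb r -> (x \in orb u) = false by move=> xr; apply: contraTF xr => /dis.
have npr x : x \in orb r -> ~~ pm x (h x).
  by move=> xr; apply: contra (dis _ (Hr x xr)) => /(pm_orb (orb_stable r))->.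
have npu x : x \in orb u -> ~~ pm x (h x).
  by move=> xu; apply/negP=> /(pm_orb (orb_stable r)); rewrite Hu // (negbTE (dis _ xu)).
have Tr x : x \in orb r -> twist (gstep c) u h x = h x by move=> xr; rewrite ffunE nu.
have Tu x : x \in orb u -> twist (gstep c) u h x = gstep c (h x) by move=> xu; rewrite ffunE xu.
have hst x : x \in B -> h (gstep c x) = gstep c (h x).
  move=> xB; case: (c) => /=; last by rewrite (solG hS).
  by apply: (@perm_inj _ g); rewrite permKV -(solG hS) ?permKV // -sB permKV.
have gcE x : gstep c (if c then g x else x) = (if ~~ c then g x else x).
  by case: (c) => //=; rewrite permK.
split; last by rewrite Tr ?orb_id.
apply/sol_memP; split=> [x|x xB]; last first.
  by move: (xB); rewrite in_setU negb_or ffunE => /andP[_ /negbTE->]; rewrite (sol_out hS).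
rewrite in_setU => /orP[xr|xu].
  have xB := Br x xr; have hu := Hr x xr.
  split; first by rewrite Tr // Bu.
  have gxr : g x \in orb r by rewrite orb_stable.
  have nxr : neg x \in orb r by rewrite orb_stable.
  apply/and3P; split.
  - by rewrite !Tr // (solG hS).
  - by rewrite Tr //; apply/implyP/(solU hS).
  rewrite (Tr _ xr) (Tr _ nxr) (Tu _ hu) (sol_sq hS) ?npr ?orbT // gcE.
  rewrite (sol_neg hS) ?npr ?orbT // (negbTE (npr x xr)).
  by case: (c); rewrite /= !eqxx.
have xB := Bu x xu; have hr' := Hu x xu.
have gxu : g x \in orb u by rewrite orb_stable.
have nxu : neg x \in orb u by rewrite orb_stable.
have gh : gstep c (h x) \in orb r by rewrite gstep_mem //; apply: orb_stable.
split; first by rewrite Tu // Br.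
apply/and3P; split.
- by rewrite !Tu // (solG hS) // gstep_g.
- by rewrite Tu // gstep_U; apply/implyP/(solU hS).
rewrite (Tu _ xu) (Tu _ nxu) (Tr _ gh) hst ?(Br _ hr') // (sol_sq hS) ?npu ?orbT //.
rewrite gcE (sol_neg hS) ?npu ?orbT // gstep_neg.
have -> : pm x (gstep c (h x)) = false.
  by apply/negP=> /(pm_orb (orb_stable r)); rewrite gh (negbTE (dis _ xu)).
by case: (c); rewrite /= !eqxx.
Qed.

(** A function exchanging two disjoint orbits has no fixed point there, so every sign is 1 and the
    bijection [twist] is all that is needed. *)
Lemma off_orbit_count r u : u \notin orb r ->
  (\sum_(h in sol false (orb r :|: orb u) | h r == u) sg (fixin h (orb r :|: orb u)) =
   \sum_(h in sol true (orb r :|: orb u) | h r == u) 1)%R.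
Proof.
move=> ur; set B := _ :|: _.
rewrite [RHS](reindex_onto (twist (gstep false) u) (twist (gstep true) u)) /=; last first.
  by move=> h _; apply/ffunP=> x; rewrite !ffunE; case: (x \in orb u) => //=; rewrite permKV.
apply: eq_big => [h|h /andP[hS /eqP hr]].
  apply/andP/andP=> [[hS /eqP hr]|[/andP[hS /eqP hr] /eqP Eh]].
    have [/= -> ->] := twist_sol ur hS hr; rewrite eqxx; split=> //.
    by apply/eqP/ffunP=> x; rewrite !ffunE; case: (x \in orb u) => //=; rewrite permK.
  by have [/=] := twist_sol ur hS hr; rewrite Eh => -> ->.
rewrite [fixin h B](_ : _ = set0) ?sg0 //.
apply/setP=> x; rewrite inE in_set0; apply/negP=> /andP[xB /eqP hx].
have sB : stable B by apply: stableU; apply: orb_stable.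
have rB : r \in B by rewrite /B in_setU orb_id.
have [] := sol_swap sB rB hS; rewrite hr // => Hr Hu.
move: xB; rewrite in_setU => /orP[xr|xu].
  by have := orb_disj ur (Hr x xr); rewrite hx xr.
by have := orb_disj ur xu; rewrite -{1}hx Hu.
Qed.

Lemma expg_fix x i : ((g ^+ i) x == x) = (#|porbit g x| %| i)%N.
Proof.
set d := #|_|; have d0 : (0 < d)%N by rewrite lt0n card_porbit_neq0.
have Hd : (g ^+ d) x = x by rewrite permX iter_porbit.
have Hq q : (g ^+ (q * d)) x = x.
  by elim: q => [|q IHq]; rewrite ?expg0 ?perm1 // mulSn expgD permM Hd.
rewrite {1}(divn_eq i d) expgD permM Hq /dvdn permX.
have lt_m : (i %% d < d)%N by rewrite ltn_mod.
rewrite -[X in _ == X]/(iter 0 g x) -!(nth_traject g _ x (n := d)) //.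
by rewrite nth_uniq ?size_traject ?uniq_traject_porbit.
Qed.

Definition negif (e : bool) x := if e then neg x else x.

Lemma negif_expg e i x : (g ^+ i) (negif e x) = negif e ((g ^+ i) x).
Proof. by case: e => //=; rewrite expg_neg. Qed.

Lemma negif_g e x : g (negif e x) = negif e (g x).
Proof. by case: e => //=; rewrite gneg. Qed.

Lemma negif_stable Z e x : stable Z -> (negif e x \in Z) = (x \in Z).
Proof. by move=> sZ; case: e; rewrite //= sZ. Qed.

(** [Z/d] has at most one element of order two, and twice that element is 0: both [m] and [t] are
    odd multiples of [d/2]. *)
Lemma dvdn_double_add d m t : (d %| m + m)%N -> (d %| t + t)%N -> ~~ (d %| m)%N -> ~~ (d %| t)%N ->
  (d %| m + t)%N.
Proof.
have half i : (d %| i + i)%N -> ~~ (d %| i)%N -> exists a, d = d./2.*2 /\ i = ((a.*2.+1) * d./2)%N.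
  move=> d2 di; have Ed : d = (d./2).*2.
    apply/esym/even_halfK; apply/negP=> od; case/negP: di; rewrite -(@Gauss_dvdr _ 2) ?coprimen2 //.
    by rewrite mul2n -addnn.
  have: (d./2 %| i)%N by move: d2; rewrite addnn {1}Ed -!muln2 dvdn_pmul2r.
  case/dvdnP=> b Eb; exists b./2; split=> //; rewrite {1}Eb -[b in LHS]odd_double_half.
  suff -> : odd b by [].
  apply: contraR di => /even_halfK Eb2; rewrite Eb -Eb2.
  by rewrite -muln2 -mulnA mul2n -Ed dvdn_mull.
move=> m2 t2 /(half _ m2)[a [Ed ->]] /(half _ t2)[b [_ ->]].
by rewrite -mulnDl addSn addnS -doubleD -doubleS -muln2 -mulnA mul2n -Ed dvdn_mull.
Qed.

(** * One stable orbit *)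

Section OneOrbit.
Variable r : X.
Hypothesis rU : r \in U.
Local Notation O := (porbit g r).
Local Notation d := #|porbit g r|.

Let d_gt0 : (0 < d)%N. Proof. by rewrite lt0n card_porbit_neq0. Qed.

Lemma orb_dec x : x \in orb r -> exists e, exists i, x = negif e ((g ^+ i) r).
Proof.
rewrite inE => /orP[]/porbitP[i ->]; first by exists false, i.
by exists true, i; rewrite /= expg_neg.
Qed.

Lemma orb_fix x i : x \in orb r -> ((g ^+ i) x == x) = (d %| i)%N.
Proof.
move=> /orb_dec[e [j ->]]; rewrite negif_expg -permM -expgD addnC expgD permM.
have -> a b : (negif e a == negif e b) = (a == b).
  by case: e => //=; apply: (inj_eq (can_inj negK)).
by rewrite (inj_eq perm_inj) expg_fix.
Qed.

(** The orbit is then a single cycle of even length [d], on which [neg] is [g ^+ m] with [m] of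
    order two in [Z/d], and [h] is a power [g ^+ t]. A square root needs [2t = 1] modulo an even
    number. An involution has [t] equal to 0 or [m], so it sends [r] to [r] or [neg r], where only
    the projection case is allowed. A projection would have to identify [h r] with [neg (h r)], as
    it commutes with [g ^+ m]. *)
Lemma neg_orbit_sol c : neg r \in O -> sol c (orb r) = set0.
Proof.
move=> /porbitP[m Em]; apply/setP=> h; rewrite in_set0; apply/negP=> hS.
have rY := orb_id r; have hY : h r \in orb r by rewrite (solZ _ hS).
have d_m : ~~ (d %| m)%N by rewrite -expg_fix -Em neg_neq.
have d_2m : (d %| m + m)%N by rewrite -expg_fix expgD permM -Em expg_neg -Em negK.
have Ed : d = (d./2).*2.
  apply/esym/even_halfK; apply/negP=> od; case/negP: d_m; rewrite -(@Gauss_dvdr _ 2) ?coprimen2 //.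
  by rewrite mul2n -addnn.
have [t Et] : exists t, h r = (g ^+ t) r.
  case: (orb_dec hY) => -[] [i ->] /=; last by exists i.
  by exists (m + i)%N; rewrite expgD permM -Em expg_neg.
have hh : h (h r) = (g ^+ (t + t)) r.
  by rewrite {1}Et (sol_expg _ (orb_stable r) hS) // Et expgD permM.
have [cf|] := boolP (c || ~~ pm r (h r)).
  have := sol_sq hS rY cf; rewrite hh; case: c cf {hS} => [_|/= npm] E.
    have: (d %| t + t + d.-1)%N.
      by rewrite -expg_fix expgD permM E -permM -expgS prednK // expg_fix.
    have d2 : (2 %| d)%N by rewrite Ed -muln2 dvdn_mull.
    move=> /(dvdn_trans d2); rewrite dvdn2 !oddD addbb /=.
    by rewrite -(prednK d_gt0) dvdn2 /= negbK in d2; rewrite d2.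
  have d_2t : (d %| t + t)%N by rewrite -expg_fix E.
  have d_t : ~~ (d %| t)%N.
    by rewrite -expg_fix; apply: contra npm => /eqP tr; rewrite Et tr /pm eqxx.
  case/negP: npm; rewrite /pm Et; apply/orP; right; apply/eqP/(can_inj negK).
  rewrite negK -expg_neg Em -permM -expgD; apply/eqP; rewrite expg_fix.
  exact: dvdn_double_add.
rewrite negb_or negbK => /andP[/negbTE c0 pr]; rewrite c0 in hS.
have /eqP := sol_pm hS rY pr; rewrite Em (sol_expg _ (orb_stable r) hS) //.
suff -> : (g ^+ m) (h r) = neg (h r) by rewrite (negbTE (neg_neq _)).
by case/orP: pr => /eqP->; rewrite ?expg_neg -Em.
Qed.

Section FreeOrbit.
Hypothesis nrO : neg r \notin O.

(* [b] tells whether the function is invariant under the negation of its argument,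
   rather than commuting with it; [s] is the sign of the image of [r]. *)
Definition loc s b i : {ffun X -> X} :=
  [ffun x => if x \in O then negif s ((g ^+ i) x) else
             if x \in porbit g (neg r) then negif (s (+) b) ((g ^+ i) x) else x].

(** Exponents live in [Z/d], with [d.-1] standing for [-1]: a square root requires [2i = 1], a
    projection [i = 0], and an involution an [i] of order exactly two, since [i = 0] belongs to the
    projections. *)
Definition loc_ok c (b : bool) i :=
  if c then ~~ b && (d %| i + i + d.-1)%N else
  if b then (d %| i)%N else (d %| i + i)%N && ~~ (d %| i)%N.

Lemma negO x : x \in O -> neg x \in porbit g (neg r).
Proof. by rewrite mem_porbit_neg. Qed.

Lemma O_disj x : x \in porbit g (neg r) -> (x \in O) = false.
Proof.
rewrite -!eq_porbit_mem => /eqP ->; rewrite eq_sym eq_porbit_mem porbit_sym.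
exact: negbTE.
Qed.

Lemma O_expg i x : ((g ^+ i) x \in O) = (x \in O).
Proof. by rewrite -!eq_porbit_mem porbit_perm. Qed.

Lemma O_orb x : x \in O -> x \in orb r. Proof. by rewrite inE => ->. Qed.

Lemma orb_dec_O y : y \in orb r -> exists e, exists2 x, x \in O & y = negif e x.
Proof. by case/orb_dec=> e [i ->]; exists e, ((g ^+ i) r); rewrite ?mem_porbit. Qed.

Lemma negif_eq e e' x y : x \in O -> y \in O ->
  (negif e x == negif e' y) = (e == e') && (x == y).
Proof.
have H a b : a \in O -> b \in O -> (neg a == b) = false.
  by move=> /negO/O_disj aO bO; apply: contraFF aO => /eqP->.
move=> xO yO; case: e; case: e'; rewrite /negif ?eqxx //=.
- exact: (inj_eq (can_inj negK)).
- by rewrite H.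
by rewrite eq_sym H.
Qed.

Lemma locE s b i e x : x \in O ->
  loc s b i (negif e x) = negif (s (+) e (+) (e && b)) ((g ^+ i) x).
Proof.
move=> xO; rewrite ffunE; case: e => /=; last by rewrite xO !addbF.
rewrite O_disj ?negO // expg_neg; case: (s) (b) => [] [] /=; rewrite ?negK //.
Qed.

Lemma loc_sol s b i c : loc_ok c b i -> (s ==> (neg r \in U)) -> loc s b i \in sol c (orb r).
Proof.
move=> ok sU; apply/sol_memP; split=> [y|x]; last first.
  by rewrite inE negb_or ffunE => /andP[/negbTE-> /negbTE->].
case/orb_dec_O=> e [x xO ->]; have GxO : (g ^+ i) x \in O by rewrite O_expg.
split.
  by rewrite locE // !(negif_stable _ _ (orb_stable r)) O_orb.
have OU z : z \in O -> z \in U.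
  by case/porbitP=> t ->; elim: t => [|t IHt]; rewrite ?expg0 ?perm1 // expgSr permM gU.
apply/and3P; split.
- rewrite negif_g !locE ?mem_porbit_perm // negif_g -!permM. by rewrite -expgS expgSr.
- apply/implyP=> yU; have [nrU|nrU] := boolP (neg r \in U); first exact: UnegT nrU.
  move: sU; rewrite (negbTE nrU) implybF => /negbTE ->; rewrite locE //.
  case: e yU => /= [nxU|_]; last exact: OU.
  by case/negP: nrU; apply: UnegT (OU _ xO) nxU.
have -> : neg (negif e x) = negif (~~ e) x by case: (e); rewrite //= negK.
have G2xO : (g ^+ i) ((g ^+ i) x) \in O by rewrite !O_expg.
rewrite /pm.
have -> : neg (negif e x) = negif (~~ e) x by case: (e); rewrite //= negK.
rewrite !locE // !negif_eq //.
have -> z a : neg (negif a z) = negif (~~ a) z by case: (a); rewrite //= negK.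
move: ok; rewrite /loc_ok; case: c.
  case/andP=> /negbTE-> di; rewrite negif_g !negif_eq ?mem_porbit_perm ?O_expg //.
  suff -> : (g ^+ i) ((g ^+ i) x) == g x by rewrite eqxx; case: (s); case: (e).
  (* On the orbit [g ^+ d.-1] is the inverse of [g]; applying it turns the goal into
     [g ^+ (i + i + d.-1)] fixing [x]. *)
  apply/eqP/(@perm_inj _ (g ^+ d.-1)); have Ed : (g ^+ d) x = x by apply/eqP; rewrite orb_fix ?O_orb.
  by rewrite -!permM -expgS prednK // Ed -!expgD addnA; apply/eqP; rewrite orb_fix ?O_orb.
rewrite -[(g ^+ i) ((g ^+ i) x)]permM -expgD; rewrite !negif_eq ?O_expg //.
rewrite !orb_fix ?O_orb //; case: b => [-> /=|/andP[-> /negbTE ->] /=].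
  by rewrite !andbT eqxx; case: (s); case: (e).
by rewrite !andbF /= !eqxx !andbT; case: (s); case: (e).
Qed.

(** Commuting with [g], [h] is determined on the cycle of [r] by [h r]. Whether [h] is a projection
    is constant along this cycle, and this settles the values on the cycle of [neg r]. *)
Lemma sol_loc c h : h \in sol c (orb r) ->
  exists s, exists b, exists i, [/\ h = loc s b i, loc_ok c b i & s ==> (neg r \in U)].
Proof.
move=> hS; have rY := orb_id r; have rO := porbit_id g r.
have [s [i Ei]] : exists s, exists i, h r = negif s ((g ^+ i) r).
  by apply: orb_dec; rewrite (solZ _ hS).
have pmE : pm r (h r) = (d %| i)%N.
  rewrite /pm Ei -expg_fix -[X in _ == X]/(negif false r) -[X in _ || (_ == X)]/(negif true r).
  by rewrite !negif_eq ?O_expg //; case: (s); rewrite /= ?orbF.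
have sU : s ==> (neg r \in U).
  apply/implyP=> s1; have := solU hS rY rU; rewrite Ei s1 /= -expg_neg.
  by elim: (i) => [|t IHt]; rewrite ?expg0 ?perm1 // expgSr permM gU.
have hO t : h ((g ^+ t) r) = negif s ((g ^+ i) ((g ^+ t) r)).
  by rewrite (sol_expg _ (orb_stable r) hS) // Ei negif_expg -!permM -!expgD addnC.
pose b := ~~ (c || ~~ pm r (h r)).
have hN t : h (neg ((g ^+ t) r)) = negif (s (+) b) (neg ((g ^+ i) ((g ^+ t) r))).
  have tY : (g ^+ t) r \in orb r by apply: O_orb; rewrite O_expg.
  have pmt : pm ((g ^+ t) r) (h ((g ^+ t) r)) = pm r (h r).
    by rewrite /pm (sol_expg _ (orb_stable r) hS) // -expg_neg !(inj_eq perm_inj).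
  rewrite /b; case: (boolP (c || _)) => [cf|].
    by rewrite (sol_neg hS) ?pmt // hO addbF; case: (s).
  rewrite negb_or negbK => /andP[/negbTE c0 pr]; rewrite c0 in hS.
  by rewrite (sol_pm hS) ?pmt // hO addbT; case: (s); rewrite //= negK.
exists s, b, i; split=> //.
  apply/ffunP=> x; have [xY|xY] := boolP (x \in orb r); last first.
    rewrite (sol_out hS) // ffunE; move: xY; rewrite inE negb_or.
    by case/andP=> /negbTE-> /negbTE->.
  have [[] [t ->]] := orb_dec xY; rewrite locE ?O_expg //= ?hO ?addbF //.
  by rewrite hN; case: (s) (b) => [] []; rewrite //= negK.
rewrite /loc_ok /b pmE; have hh : h (h r) = (g ^+ (i + i)) r \/ ~~ c && (d %| i)%N.
  have [cf|cf] := boolP (~~ c && (d %| i)%N); [by right | left].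
  have cf' : c || ~~ (d %| i)%N by move: cf; rewrite negb_and negbK.
  rewrite {1}Ei; have := hN i; have := hO i; rewrite /b pmE cf' addbF => E1 E2.
  by case: (s) E1 E2 => /= E1 E2; rewrite ?E1 ?E2 ?negK expgD permM.
have := sol_sq hS rY; rewrite pmE; case: (c) hh => /= hh.
  case: hh => // -> /(_ isT) E.
  by rewrite -expg_fix expgD permM E -permM -expgS prednK // expg_fix.
case: (boolP (d %| i)%N) hh => //= di [] // -> /(_ isT) E.
by rewrite andbT -expg_fix E.
Qed.

Lemma card_neg_porbit : #|porbit g (neg r)| = d.
Proof.
rewrite -(card_imset _ (can_inj negK)); congr #|pred_of_set _|; apply/setP=> x.
apply/imsetP/idP=> [[y yO ->]|xO]; last by exists (neg x); rewrite ?negK // mem_porbit_neg.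
by rewrite -[r]negK mem_porbit_neg.
Qed.

(** The fixed points of a projection form one whole cycle, that of [r] or of [neg r], which is a
    [d]-cycle; an involution fixes nothing. *)
Lemma sg_loc s b i : loc_ok false b i ->
  sg (fixin (loc s b i) (orb r)) = (if b then (-1) ^+ d.+1 else 1)%R.
Proof.
move=> ok; have E e x : x \in O ->
    (negif e x \in fixin (loc s b i) (orb r)) = b && (e == s).
  move=> xO; rewrite mem_fixin (negif_stable _ _ (orb_stable r)) (O_orb xO).
  rewrite locE // negif_eq ?O_expg // (orb_fix _ (O_orb xO)) /=.
  by move: ok; rewrite /loc_ok; case: b => [->|/andP[_ /negbTE->]]; rewrite ?andbF //; case: (s); case: e.
case: b ok E => ok E.
  have -> : fixin (loc s true i) (orb r) = porbit g (negif s r).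
    apply/setP=> y; have [yY|yY] := boolP (y \in orb r).
      have [e [x xO ->]] := orb_dec_O yY; rewrite E //=.
      case: (s); case: e => /=; rewrite ?mem_porbit_neg ?xO //.
        by apply/esym/negbTE/negP=> /O_disj; rewrite xO.
      by rewrite O_disj // negO.
    rewrite mem_fixin (negbTE yY); apply/esym/negbTE; apply: contra yY.
    by case: (s) => /= yO; rewrite inE yO ?orbT.
  by rewrite sg_porbit; case: (s); rewrite /= ?card_neg_porbit.
rewrite [X in sg X](_ : _ = set0) ?sg0 //; apply/setP=> y; rewrite in_set0.
have [yY|yY] := boolP (y \in orb r); last by rewrite mem_fixin (negbTE yY).
by have [e [x xO ->]] := orb_dec_O yY; rewrite E.
Qed.

(* Toggles [b] in [loc]: for cycles of even length this is the sign-reversing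
   involution, for odd length the bijection onto the square roots. *)
Definition shift j h : {ffun X -> X} :=
  [ffun x => if x \in O then (g ^+ j) (h x) else
             if x \in porbit g (neg r) then neg ((g ^+ j) (h x)) else h x].

Lemma shift_loc j s b i : shift j (loc s b i) = loc s (~~ b) (i + j).
Proof.
apply/ffunP=> x; rewrite !ffunE; case: (x \in O); first by rewrite negif_expg expgD permM.
case: (x \in _) => //; rewrite negif_expg expgD permM.
by case: (s) (b) => [] []; rewrite //= negK.
Qed.

Lemma loc_period s b i : loc s b (i + d) = loc s b i.
Proof.
apply/ffunP=> x; rewrite !ffunE; have H : x \in orb r -> (g ^+ (i + d)) x = (g ^+ i) x.
  by move=> xY; rewrite addnC expgD permM; congr ((g ^+ i) _); apply/eqP; rewrite orb_fix.
by move: H; rewrite inE; case: (x \in O) => [->|] //; case: ifP => // _ ->.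
Qed.

Lemma shiftK c e j h : (e + j)%N = d -> h \in sol c (orb r) -> shift j (shift e h) = h.
Proof.
by move=> ej /sol_loc[s [b [i [-> _ _]]]]; rewrite !shift_loc negbK -addnA ej loc_period.
Qed.

Lemma odd_orbit_count : odd d ->
  (\sum_(h in sol false (orb r)) sg (fixin h (orb r)) = \sum_(h in sol true (orb r)) 1)%R.
Proof.
(* [e] and [j] are the halves of 1 and of -1 in [Z/d]. For odd [d] no exponent has order two, so all
   functions on the left are projections, and adding [e] to their exponent 0 gives the solution of
   [2i = 1]. *)
move=> od; pose j := d./2; pose e := j.+1.
have Ed : d = (j + j).+1 by rewrite addnn -[LHS]odd_double_half od.
have ed : (e + j)%N = d by rewrite Ed.
have ee : (e + e)%N = d.+1 by rewrite Ed addnS.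
have jj : (j + j)%N = d.-1 by rewrite [in RHS]Ed.
rewrite [RHS](reindex_onto (shift e) (shift j)) /=; last first.
  by move=> h hS; rewrite (shiftK (c := true)) // addnC.
apply: eq_big => [h|h /sol_loc[s [b [i [-> ok _]]]]]; last first.
  by rewrite sg_loc //; case: b ok => //; rewrite -signr_odd /= od.
apply/idP/andP=> [hS|[hS /eqP Eh]].
  split; last by rewrite (shiftK (c := false)).
  have /sol_loc[s [b [i [-> ok sU]]]] := hS; rewrite shift_loc; apply: loc_sol => //.
  move: ok; rewrite /loc_ok; case: b => [di|/andP[]].
    by rewrite addnACA ee -addnA addSn -addnS prednK // dvdn_addr ?dvdn_add // dvdn_add.
  by rewrite addnn -mul2n Gauss_dvdr ?coprimen2 // => ->.
rewrite -Eh; have /sol_loc[s [b [i [-> ok sU]]]] := hS; rewrite shift_loc; apply: loc_sol => //.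
move: ok; rewrite /loc_ok; case: b => [//|/= di].
by rewrite -(@Gauss_dvdr _ 2) ?coprimen2 // mul2n -addnn addnACA jj.
Qed.

Lemma even_orbit_count : ~~ odd d ->
  (\sum_(h in sol false (orb r)) sg (fixin h (orb r)) = \sum_(h in sol true (orb r)) 1)%R.
Proof.
(* Adding the element [e] of order two exchanges the exponent of the projections with that of the
   involutions. *)
move=> od; pose e := d./2; have ee : (e + e)%N = d by rewrite addnn even_halfK.
have e_d : ~~ (d %| e)%N.
  rewrite /dvdn modn_small -?lt0n; first by rewrite -double_gt0 -addnn ee.
  by rewrite -[in ltnRHS]ee -addn1 leq_add2l -double_gt0 -addnn ee.
have okS b i : loc_ok false b i -> loc_ok false (~~ b) (i + e).
  rewrite /loc_ok; case: b => /= [di|/andP[d2 d1]].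
    by rewrite addnACA ee (dvdn_add (dvdn_add di di) (dvdnn _)) dvdn_addr.
  by apply: dvdn_double_add; rewrite // ee.
have shS h : h \in sol false (orb r) -> shift e h \in sol false (orb r).
  by move=> /sol_loc[s [b [i [-> ok sU]]]]; rewrite shift_loc; apply: loc_sol => //; apply: okS.
(* The right-hand side is empty: a square root would need [2i = 1] modulo an even number. *)
rewrite [RHS]big1 => [|h hS]; last first.
  have /sol_loc[s [b [i [_ /andP[_]]]]] := hS; have: (2 %| d)%N by rewrite dvdn2.
  move=> d2 /(dvdn_trans d2); rewrite dvdn2 !oddD addbb /=.
  by rewrite -(prednK d_gt0) dvdn2 /= negbK in d2; rewrite d2.
set S := (\sum_(h in _) _)%R.
(* [shift e] pairs summands of opposite signs: an even cycle contributes -1 for a projection, the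
   empty set 1 for an involution. *)
suff /eqP : (S = - S)%R by rewrite -addr_eq0 -mulr2n mulrn_eq0 => /eqP.
rewrite {1}/S (reindex_onto (shift e) (shift e)) /=; last first.
  by move=> h hS; rewrite (shiftK (c := false)).
rewrite /S -sumrN; apply: eq_big => [h|h /andP[hS /eqP Eh]].
  apply/andP/idP=> [[hS /eqP<-]|hS]; first exact: shS.
  by rewrite shS // (shiftK (c := false)).
have := shS _ hS; rewrite Eh => {Eh} {}hS; have := shS _ hS.
have /sol_loc[s [b [i [-> ok _]]]] := hS; rewrite shift_loc => shS'.
have ok' := okS _ _ ok; rewrite (sg_loc _ ok) (sg_loc _ ok').
by rewrite -signr_odd /= od; case: b {ok ok' shS'}; rewrite /= ?expr1 ?opprK.
Qed.

End FreeOrbit.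
Lemma one_orbit_count :
  (\sum_(h in sol false (orb r)) sg (fixin h (orb r)) = \sum_(h in sol true (orb r)) 1)%R.
Proof.
have [nO|nO] := boolP (neg r \in O); first by rewrite !neg_orbit_sol // !big_set0.
by have [/odd_orbit_count|/even_orbit_count] := boolP (odd d); apply.
Qed.

End OneOrbit.

Definition weight c Z f : algC := if c then 1%R else sg (fixin f Z).

Lemma weight_restr c Z B f : stable B -> B \subset Z ->
  weight c Z f = (weight c B (restr B f) * weight c (Z :\: B) (restr (Z :\: B) f))%R.
Proof. by case: c => sB BZ; rewrite /weight ?mulr1 //; apply: sg_restr. Qed.

Lemma sum_sol_orb c Z r : stable Z -> r \in Z ->
  (\sum_(f in sol c Z | f r \in orb r) weight c Z f =
   (\sum_(f in sol c (orb r)) weight c (orb r) f) *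
   (\sum_(f in sol c (Z :\: orb r)) weight c (Z :\: orb r) f))%R.
Proof.
move=> sZ rZ; have YZ := orb_sub sZ rZ; have sY := orb_stable r.
have := @sol_split _ c Z (orb r) predT (weight c (orb r)) (weight c (Z :\: orb r)) sY sZ YZ.
rewrite [in RHS](eq_bigl _ _ (fun _ => andbT _)) => <-.
apply: eq_big => [f|f _]; last exact: weight_restr.
have [fS|//] := boolP (f \in _); rewrite /= andbT.
apply/idP/idP => [fr|/forall_inP]; first exact: (sol_invar sZ rZ fS).
by apply; apply: orb_id.
Qed.

Lemma sum_sol_swap c Z r u : stable Z -> r \in Z -> u \in Z -> u \notin orb r ->
  (\sum_(f in sol c Z | f r == u) weight c Z f =
   (\sum_(f in sol c (orb r :|: orb u) | f r == u) weight c (orb r :|: orb u) f) *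
   (\sum_(f in sol c (Z :\: (orb r :|: orb u))) weight c (Z :\: (orb r :|: orb u)) f))%R.
Proof.
move=> sZ rZ uZ ur; set B := orb r :|: orb u; have BZ : B \subset Z by rewrite subUset !orb_sub.
have sB : stable B by apply: stableU; apply: orb_stable.
rewrite -(@sol_split _ c Z B (fun f => f r == u)) //.
apply: eq_big => [f|f _]; last exact: weight_restr.
have [fS|//] := boolP (f \in _); rewrite /= /restr ffunE in_setU orb_id /=.
rewrite andb_idl // => /eqP fr; have [] := sol_swap sZ rZ fS; rewrite fr // => Hr Hu.
by apply/forall_inP=> x /setUP[xr|xu]; apply/setUP; [right; apply: Hr | left; apply: Hu].
Qed.

(** Induction on the size of [Z], splitting by the value of [f r]. Values in the orbit of [r] give a
    factor on that orbit, any other value [u] gives a factor on the two exchanged orbits, and the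
    cofactor is the same sum on a smaller set. *)
Theorem signed_count Z : stable Z ->
  (\sum_(f in sol false Z) sg (fixin f Z) = #|sol true Z|%:R)%R.
Proof.
move=> sZ; rewrite -sum1_card natr_sum.
suff: (\sum_(f in sol false Z) weight false Z f = \sum_(f in sol true Z) weight true Z f)%R by [].
have [n] := ubnP #|Z|; elim: n Z sZ => // n IHn Z sZ ltn.
have IH B x : stable B -> x \in B -> B \subset Z ->
    (\sum_(f in sol false (Z :\: B)) weight false (Z :\: B) f =
     \sum_(f in sol true (Z :\: B)) weight true (Z :\: B) f)%R.
  move=> sB xB BZ; apply: IHn; first exact: stableD.
  apply: leq_trans (proper_card _) ltn; rewrite properE subsetDl /=.
  by apply/subsetPn; exists x; rewrite ?inE ?xB // (subsetP BZ).
have [Z0|[x xZ]] := set_0Vmem Z.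
  have E c : sol c Z = [set finfun id].
    apply/setP=> f; rewrite in_set1; apply/sol_memP/eqP=> [[_ H]|->].
      by apply/ffunP=> x; rewrite H ?ffunE // Z0 in_set0.
    by split=> x; rewrite ?ffunE // Z0 in_set0.
  rewrite !E !big_set1 /weight [fixin _ _](_ : _ = set0) ?sg0 //.
  by apply/setP=> x; rewrite mem_fixin Z0 in_set0.
(* The count on one orbit needs a representative in [U]. *)
have [r rZ rU] : exists2 r, r \in Z & r \in U.
  by have /orP[] := Ucov x; [exists x | exists (neg x); rewrite ?sZ].
have split_r c : (\sum_(f in sol c Z) weight c Z f =
    \sum_(f in sol c Z | f r \in orb r) weight c Z f +
    \sum_(u in Z :\: orb r) \sum_(f in sol c Z | f r == u) weight c Z f)%R.
  rewrite (bigID (fun f => f r \in orb r)) /=; congr (_ + _)%R.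
  rewrite (partition_big (fun f => f r) (mem (Z :\: orb r))) /=; last first.
    by move=> f /andP[fS frY]; rewrite inE frY (solZ _ fS).
  apply: eq_bigr => u /setDP[_ uY]; apply: eq_bigl => f.
  by case: eqP => [->|_]; rewrite ?andbF // uY !andbT.
rewrite !split_r !sum_sol_orb //; congr (_ * _ + _)%R.
- exact: one_orbit_count.
- by apply: (IH _ r); rewrite ?orb_id ?orb_sub //; apply: orb_stable.
apply: eq_bigr => u /setDP[uZ uY]; rewrite (sum_sol_swap false) // (sum_sol_swap true) //; congr (_ * _)%R.
  exact: off_orbit_count.
apply: (IH _ r).
- by apply: stableU; apply: orb_stable.
- by apply/setUP; left; apply: orb_id.
by apply/subUsetP; split; apply: orb_sub.
Qed.

End PartialSolutions.

(** * Signed permutations *)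

Section SignedPermutations.
Variable n : nat.
Implicit Types (x y z : Tn n) (v w : {perm Tn n}) (p : nat).

Lemma negTK : involutive (@negT n).
Proof. by case=> i b; rewrite /negT /= negbK. Qed.

Lemma negT_neq x : negT x != x.
Proof. by case: x => i []; rewrite -pair_eqE /= andbF. Qed.

Lemma negT_eq x y : (negT x == negT y) = (x == y).
Proof. exact: (inj_eq (can_inj negTK)). Qed.

Lemma negT_eqC x y : (negT x == y) = (x == negT y).
Proof. by rewrite -[y in LHS]negTK negT_eq. Qed.

Lemma eq_fst x y : x.1 = y.1 -> x = y \/ x = negT y.
Proof. by case: x y => i [] [j []] /= ->; [left|right|right|left]. Qed.

Definition neg_perm : {perm Tn n} := perm (can_inj negTK).

Lemma neg_permE x : neg_perm x = negT x. Proof. by rewrite permE. Qed.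

Lemma BCP w : reflect (forall x, w (negT x) = negT (w x)) (w \in BCset n).
Proof. by rewrite inE; apply: (iffP forallP) => H x; apply/eqP. Qed.

Lemma BC_fst_eq w x y : w \in BCset n -> x.1 = y.1 -> (w x).1 = (w y).1.
Proof. by move=> /BCP wn /eq_fst[] ->; rewrite ?wn. Qed.

Lemma BC_fst_inj w x y : w \in BCset n -> (w x).1 = (w y).1 -> x.1 = y.1.
Proof. by move=> /BCP wn /eq_fst[|]; rewrite -?wn => /perm_inj ->. Qed.

Lemma neg_perm_BC : neg_perm \in BCset n.
Proof. by apply/BCP=> x; rewrite !neg_permE. Qed.

(* When [y = -x], the product of the two transpositions would be the identity. *)
Definition st x y : {perm Tn n} :=
  if y == negT x then tperm x y else tperm x y * tperm (negT x) (negT y).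

Lemma stE x y z : st x y z =
  if z == x then y else if z == y then x else if z == negT x then negT y
  else if z == negT y then negT x else z.
Proof.
rewrite /st; case: (y =P negT x) => [->|/eqP yx].
  rewrite negTK permE /=; case: (z =P x) => // zx; case: (z =P negT x) => // zy.
rewrite permM; have xnx : (x == negT x) = false by rewrite eq_sym (negbTE (negT_neq x)).
have yny : (y == negT y) = false by rewrite eq_sym (negbTE (negT_neq y)).
rewrite [tperm x y z]permE /=.
case: (z =P x) => [_|zx].
  by rewrite permE /= (negbTE yx) yny.
case: (z =P y) => [_|zy].
  by rewrite permE /= xnx -negT_eqC eq_sym (negbTE yx).
by rewrite permE.
Qed.

Lemma stxx x : st x x = 1.
Proof.
apply/permP=> z; rewrite stE perm1.
by case: (z =P x) => [//|_]; case: (z =P negT x).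
Qed.

Lemma stL x y : st x y x = y. Proof. by rewrite stE eqxx. Qed.

Lemma st_out x y z : z.1 != x.1 -> z.1 != y.1 -> st x y z = z.
Proof.
have H u : z.1 != u.1 -> (z == u = false) /\ (z == negT u = false).
  by move=> zu; split; apply: contraNF zu => /eqP->.
by move=> /H[zx znx] /H[zy zny]; rewrite stE zx znx zy zny.
Qed.

Lemma st_BC x y : st x y \in BCset n.
Proof.
apply/BCP=> z; rewrite !stE !negT_eq !negT_eqC.
have xnx (u : Tn n) : (u == negT u) = false by rewrite eq_sym (negbTE (negT_neq u)).
case: (z =P x) => [->|zx]; first by rewrite xnx; case: (x =P negT y).
case: (z =P y) => [->|zy].
  by rewrite xnx; case: (y =P negT x) => [->|//]; rewrite ?negTK.
case: (z =P negT x) => [_|_]; first by rewrite negTK.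
by case: (z =P negT y) => // _; rewrite !negTK.
Qed.

Lemma stJ w x y : w \in BCset n -> st x y ^ w = st (w x) (w y).
Proof.
move=> /BCP wn; apply/permP=> z; rewrite -[z](permKV w) permJ !stE -!wn.
by rewrite !(inj_eq perm_inj) !(fun_if w).
Qed.

Lemma st_neg x y : st (negT x) (negT y) = st x y.
Proof.
rewrite -!neg_permE -stJ ?neg_perm_BC //; apply/conjg_fixP/commgP/permP=> z.
by rewrite !permM !neg_permE (BCP _ (st_BC _ _)).
Qed.

Lemma stC x y : st x y = st y x.
Proof.
apply/permP=> z; rewrite !stE; case: (z =P x) => [->|zx].
  by case: (x =P y) => [->|_] //.
case: (z =P y) => // zy; case: (z =P negT x) => [->|//]; case: (_ =P _) => // ->.
Qed.

(** Multiplying [w] by [st (w x) x] fixes [x] and keeps every fixed point of [w], so the number of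
    moved points decreases. *)
Lemma gen_by_st (H G : {group {perm Tn n}}) : H \subset BCset n ->
  (forall w x, w \in H -> w x != x -> (st (w x) x \in G) && (st (w x) x \in H)) ->
  H \subset G.
Proof.
move=> HB gen; apply/subsetP=> w; have [N] := ubnP #|[set x | w x != x]|.
elim: N w => // N IHN w ltN wH.
case: (pickP (fun x => w x != x)) => [x wx|fix_w]; last first.
  suff -> : w = 1 by apply: group1.
  by apply/permP=> x; rewrite perm1; apply/eqP/negbFE/fix_w.
have /andP[sG sH] := gen w x wH wx.
rewrite -(groupMr w sG); apply: IHN; last exact: groupM.
apply: leq_trans (proper_card _) (ltN : _ <= N); rewrite properE; apply/andP; split.
  apply/subsetP=> z; rewrite !inE; apply: contra => /eqP wz.
  have wn := BCP _ (subsetP HB _ wH).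
  rewrite permM wz; apply/eqP; rewrite stE.
  case: (z =P w x) => [E|_].
    by case/eqP: wx; apply: (@perm_inj _ w); rewrite -E wz.
  case: (z =P x) => [E|_]; first by move: wx; rewrite -E wz eqxx.
  case: (z =P negT (w x)) => [E|_].
    by case/eqP: wx; apply: (@perm_inj _ w); move: wz; rewrite E wn => /(can_inj negTK).
  case: (z =P negT x) => // E.
  by case/eqP: wx; move: wz; rewrite E wn => /(can_inj negTK).
apply/subsetPn; exists x; first by rewrite inE.
by rewrite inE negbK permM stL.
Qed.

Lemma sA_st (i j : 'I_n) : j = i.+1 :> nat -> sA n j = st (i, false) (j, false).
Proof.
move=> ji; rewrite /sA /tp /= ji /= !(valK i) -ji !(valK j) /st.
by rewrite -pair_eqE /= andbF.
Qed.

Lemma s0_st (i : 'I_n) : i = 0%N :> nat -> s0 n = st (i, false) (i, true).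
Proof.
by move=> i0; rewrite /s0 /tp /= -i0 !(valK i) /st eqxx.
Qed.

Lemma sm1_st (i j : 'I_n) : i = 0%N :> nat -> j = 1%N :> nat ->
  sm1 n = st (i, false) (j, true).
Proof.
move=> i0 j1; have E0 : insub 0%N = Some i :> option 'I_n by rewrite -i0 valK.
have E1 : insub 1%N = Some j :> option 'I_n by rewrite -j1 valK.
rewrite /sm1 /tp /= !E0 !E1 /st; case: eqP => // -[E]; by move: i0; rewrite -E j1.
Qed.

Definition ord_pred_nat (j : 'I_n) : 'I_n := Ordinal (leq_ltn_trans (leq_pred j) (ltn_ord j)).

Lemma ord_pred_natE (j : 'I_n) : (0 < j)%N -> j = (ord_pred_nat j).+1 :> nat.
Proof. by move=> j0; rewrite /= prednK. Qed.

(* The parabolic subgroup generated by all the simple reflections but [s_p], in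
   type A for [b = true] and in type BC for [b = false]. *)
Definition block b p : {set {perm Tn n}} := [set w in BCset n | [forall x : Tn n,
  (((w x).1 < p)%N == (x.1 < p)%N) && ((b || (p <= x.1)%N) ==> ((w x).2 == x.2))]].

Lemma blockP b p w :
  reflect [/\ w \in BCset n, forall x, ((w x).1 < p)%N = (x.1 < p)%N &
            forall x, b || (p <= x.1)%N -> (w x).2 = x.2] (w \in block b p).
Proof.
apply: (iffP setIdP) => [[wB /forallP H]|[wB H1 H2]].
  by split=> // x; have /andP[/eqP H1 /implyP H2] := H x => // /H2/eqP.
split=> //; apply/forallP=> x; rewrite H1 eqxx /=.
by apply/implyP=> /H2->.
Qed.

Lemma block_group_set b p : group_set (block b p).
Proof.
apply/group_setP; split=> [|v w /blockP[vB v1 v2] /blockP[wB w1 w2]]; apply/blockP.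
  by split=> [|x|x]; rewrite ?perm1 ?(group1 (WBC n)).
split=> [|x|x bx]; rewrite ?permM ?(groupM (G := WBC n)) ?w1 ?v1 //.
by rewrite w2 ?v2 // leqNgt v1 -leqNgt.
Qed.
Canonical block_group b p := Group (block_group_set b p).

Lemma block_BC b p : block b p \subset BCset n.
Proof. by apply/subsetP=> w /blockP[]. Qed.

Lemma st_block b p x y : (x.1 < p)%N = (y.1 < p)%N -> (b || (p <= x.1)%N -> x.2 = y.2) ->
  st x y \in block b p.
Proof.
move=> xy1 xy2; apply/blockP; split=> [|z|z bz]; first exact: st_BC.
  rewrite stE; case: (z =P x) => [->//|_]; case: (z =P y) => [->//|_].
  by case: (z =P negT x) => [->//|_]; case: (z =P negT y) => [->|].
have xy2' : b || (p <= y.1)%N -> x.2 = y.2 by rewrite leqNgt -xy1 -leqNgt.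
rewrite stE; case: (z =P x) bz => [-> /xy2 ->//|_]; case: (z =P y) => [->/xy2'->//|_].
case: (z =P negT x) => [->/= /xy2->//|_]; by case: (z =P negT y) => [->/=/xy2'->|].
Qed.

(** Conjugating by adjacent transpositions on the same side of [p] lengthens a transposition step by
    step and carries [s0] to every sign change below [p]; conjugating a transposition by a sign
    change gives the mixed ones. *)
Lemma st_gen (b : bool) p (K : {group {perm Tn n}}) :
  (forall i : 'I_n, (0 < i)%N -> i != p :> nat -> sA n i \in K) ->
  (~~ b -> (0 < p)%N -> (0 < n)%N -> s0 n \in K) ->
  forall x y, (x.1 < p)%N = (y.1 < p)%N -> (b || (p <= x.1)%N -> x.2 = y.2) -> st x y \in K.
Proof.
move=> KA K0.
have lt_mem N (i j : 'I_n) : (j < N)%N -> (i < j)%N -> (i < p)%N = (j < p)%N ->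
    st (i, false) (j, false) \in K.
  elim: N i j => // N IHN i j; rewrite ltnS => jN ij ijp.
  have j0 : (0 < j)%N by apply: leq_ltn_trans ij.
  have Ej := ord_pred_natE j0; set j' := ord_pred_nat j in Ej.
  have sj : sA n j \in K.
    by apply: KA => //; apply/eqP=> jp; move: ijp; rewrite jp ltnn -jp ij.
  have := sj; rewrite (sA_st Ej) => stj.
  have [ij'|j'i] := ltnP i j'; last first.
    suff -> : i = j' by [].
    by apply/val_inj/eqP; rewrite eqn_leq j'i andbT -ltnS -Ej.
  have j'p : (i < p)%N = (j' < p)%N.
    by move: ijp ij' Ej; case: (ltnP j p); case: (ltnP j' p); case: (ltnP i p) => //; lia.
  have j'N : (j' < N)%N by rewrite -ltnS -Ej.
  have -> : st (i, false) (j, false) = st (i, false) (j', false) ^ st (j', false) (j, false).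
    by rewrite stJ ?st_BC // stL st_out //= -val_eqE /= neq_ltn ?ij' ?ij.
  by rewrite groupJ // IHN.
have eq_mem (i j : 'I_n) e : (i < p)%N = (j < p)%N -> st (i, e) (j, e) \in K.
  move=> ijp; have -> : st (i, e) (j, e) = st (i, false) (j, false).
    by case: e => //; rewrite -[RHS]st_neg.
  case: (ltngtP i j) => [ij|ji|/val_inj->]; last by rewrite stxx group1.
    exact: lt_mem (ltn_ord j) ij ijp.
  by rewrite stC; apply: lt_mem (ltn_ord i) ji (esym ijp).
case=> i e [j e'] /= ijp ee'.
have [<-|ne] := eqVneq e e'; first exact: eq_mem.
have [nb ip] : ~~ b /\ (i < p)%N.
  by apply/andP; rewrite ltnNge -negb_or; apply: contra ne => /ee'->.
have sign_mem (k : 'I_n) : (k < p)%N -> st (k, false) (k, true) \in K.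
  move=> kp; have n0 : (0 < n)%N by apply: leq_ltn_trans (ltn_ord k).
  pose o := Ordinal n0; have op : (o < p)%N = (k < p)%N by rewrite kp; apply: leq_ltn_trans kp.
  have p0 : (0 < p)%N by apply: leq_ltn_trans kp.
  have := K0 nb p0 n0; rewrite (s0_st (i := o)) // => so.
  have -> : st (k, false) (k, true) = st (o, false) (o, true) ^ st (o, false) (k, false).
    rewrite stJ ?st_BC // stL; congr st.
    by rewrite -[(o, true)]/(negT (o, false)) (BCP _ (st_BC _ _)) stL.
  by rewrite groupJ // eq_mem.
have -> : st (i, e) (j, e') = st (i, false) (j, true).
  by case: e e' ne {ee'} => [] [] // _; rewrite -[LHS]st_neg.
have [<-|nij] := eqVneq i j; first exact: sign_mem.
have -> : st (i, false) (j, true) = st (i, false) (j, false) ^ st (j, false) (j, true).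
  by rewrite stJ ?st_BC // stL st_out.
by rewrite groupJ ?eq_mem ?sign_mem -?ijp.
Qed.

Definition JA p : {set {perm Tn n}} := [set sA n i | i : 'I_n & (0 < i)%N && (val i != p)].
Definition JB p : {set {perm Tn n}} := [set genBC n i | i : 'I_n & val i != p].
Definition JD p : {set {perm Tn n}} := [set Defs.genD n i | i : 'I_n & val i != p].

Lemma sA_block b p (i : 'I_n) : (0 < i)%N -> i != p :> nat -> sA n i \in block b p.
Proof.
move=> i0 ip; have Ei := ord_pred_natE i0; rewrite (sA_st Ei); apply: st_block => //=.
by rewrite /= in Ei; move: ip; lia.
Qed.

Lemma block_gen (b : bool) p (K : {group {perm Tn n}}) :
  (forall i : 'I_n, (0 < i)%N -> i != p :> nat -> sA n i \in K) ->
  (~~ b -> (0 < p)%N -> (0 < n)%N -> s0 n \in K) -> block b p \subset K.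
Proof.
move=> KA K0; apply: gen_by_st => [|w x wH _]; first exact: block_BC.
have /blockP[_ H1 H2] := wH; have H2' : b || (p <= (w x).1)%N -> (w x).2 = x.2.
  by rewrite leqNgt H1 -leqNgt; apply: H2.
by rewrite (st_gen KA K0) //= st_block.
Qed.

Lemma gen_JA p : <<JA p>> = block true p.
Proof.
apply/eqP; rewrite eqEsubset gen_subG; apply/andP; split.
  by apply/subsetP=> _ /imsetP[i iP ->]; rewrite inE in iP; case/andP: iP => *; apply: sA_block.
apply: block_gen => // i i0 ip; apply/mem_gen/imsetP; exists i => //.
by rewrite inE i0.
Qed.

Lemma gen_JB p : <<JB p>> = block false p.
Proof.
apply/eqP; rewrite eqEsubset gen_subG; apply/andP; split.
  apply/subsetP=> _ /imsetP[i ip ->]; rewrite inE /= in ip; rewrite /genBC; case: eqP => [i0|/eqP].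
    rewrite (s0_st i0); apply: st_block => //=.
    by move: ip => /=; rewrite i0 leqn0 eq_sym => /negbTE ->.
  by rewrite -lt0n => i0; apply: sA_block.
apply: block_gen => [i i0 ip | _ p0 n0]; apply: mem_gen.
  by apply/imsetP; exists i; rewrite ?inE // /genBC -[_ == _]negbK -lt0n i0.
by apply/imsetP; exists (Ordinal n0); rewrite ?inE //= eq_sym -lt0n.
Qed.

Lemma SA_JA : SA n = JA 0.
Proof.
apply/setP=> w; apply/imsetP/imsetP => -[i H ->]; rewrite inE in H; exists i; rewrite ?inE //.
  by rewrite H -lt0n.
by case/andP: H.
Qed.

Lemma WA_block : WA n = block true 0 :> {set _}.
Proof. by rewrite /WA /= SA_JA gen_JA. Qed.

Lemma nsign_sign0 w : (forall x, (w x).2 = x.2) -> nsign w = false.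
Proof. by move=> H; rewrite /nsign big1 // => i _; rewrite H. Qed.

Lemma s0_BC : s0 n \in BCset n.
Proof.
have [n0|] := ltnP 0 n; first by rewrite (s0_st (i := Ordinal n0)) // st_BC.
rewrite leqn0 => /eqP n0; rewrite /s0 /tp /= insubN ?(group1 (WBC n)) //.
by rewrite n0.
Qed.

Lemma s0_sq : s0 n ^+ 2 = 1.
Proof.
rewrite /s0 /tp; case: insubP => [i _ _|_]; last by rewrite expg1n.
by rewrite expgS expg1 tperm2.
Qed.

Lemma nsign_s0 : (0 < n)%N -> nsign (s0 n) = true.
Proof.
move=> n0; pose o := Ordinal n0; rewrite (s0_st (i := o)) // /nsign (bigD1 o) //= stL.
by rewrite big1 // => i io; rewrite st_out.
Qed.

Lemma DP w : reflect (w \in BCset n /\ nsign w = false) (w \in Dset n).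
Proof. by apply: (iffP setIdP) => [[? /negbTE]|[? ->]]. Qed.

Lemma sA_D (i : 'I_n) : (0 < i)%N -> sA n i \in Dset n.
Proof.
move=> i0; have /blockP[B _ H] : sA n i \in block true 0.
  by apply: sA_block => //; rewrite -lt0n.
by apply/DP; rewrite nsign_sign0 // => x; apply: H.
Qed.

Hypothesis n_gt1 : (1 < n)%N.
Let o0 : 'I_n := Ordinal (ltnW n_gt1).
Let o1 : 'I_n := Ordinal n_gt1.

Lemma sA1J : sA n 1 ^ s0 n = sm1 n.
Proof.
rewrite (sA_st (i := o0) (j := o1)) // stJ ?s0_BC // (s0_st (i := o0)) //.
by rewrite stL st_out //= (sm1_st (i := o0) (j := o1)) // -st_neg.
Qed.

Lemma s0V : (s0 n)^-1 = s0 n.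
Proof. by apply/eqP; rewrite eq_invg_mul -expg2 s0_sq. Qed.

Lemma sm1J : sm1 n ^ s0 n = sA n 1.
Proof. by rewrite -sA1J -{2}s0V conjgK. Qed.

Lemma sm1_D : sm1 n \in Dset n.
Proof.
have /DP[B1 N1] := sA_D (i := o1) isT.
have B : sm1 n \in BCset n by rewrite -sA1J (groupJ (G := WBC n)) ?s0_BC.
apply/DP; split=> //; rewrite -sA1J conjgE s0V (nsignM s0_BC (groupM (G := WBC n) B1 s0_BC)).
by rewrite (nsignM B1 s0_BC) N1 addbb.
Qed.

(** For [p > 0], [s0] normalizes the subgroup and generates the whole block with it, so an element
    of the block lies in the subgroup or in its coset by [s0]; the parity [nsign] excludes the
    latter. For [p = 0] the block is already unsigned. For [p = 1] the statement fails, since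
    [sA n 1] is omitted but its conjugate [sm1 n] is kept. *)
Lemma gen_JD p : p != 1%N -> <<JD p>> = block false p :&: Dset n.
Proof.
move=> p1; apply/eqP; rewrite eqEsubset gen_subG; apply/andP; split.
  apply/subsetP=> _ /imsetP[i ip ->]; rewrite inE /= in ip; rewrite /Defs.genD; case: eqP => [i0|/eqP].
    rewrite inE sm1_D andbT (sm1_st (i := o0) (j := o1)) //; apply: st_block => /=.
      by move: ip p1; rewrite i0; lia.
    by move: ip p1; rewrite i0; lia.
  by rewrite -lt0n => i0; rewrite inE sA_block // sA_D.
have KA (i : 'I_n) : (0 < i)%N -> i != p :> nat -> sA n i \in <<JD p>>.
  move=> i0 ip; apply/mem_gen/imsetP; exists i; rewrite ?inE //.
  by rewrite /Defs.genD -[_ == _]negbK -lt0n i0.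
have [p0|p0] := posnP p.
  apply: subset_trans (subsetIl _ _) _; apply: block_gen KA _.
  by rewrite p0.
have Ksm : sm1 n \in <<JD p>>.
  by apply/mem_gen/imsetP; exists o0; rewrite ?inE //= eq_sym -lt0n.
(* Conjugation by [s0] exchanges [sA n 1] and [sm1 n], both present here, and fixes the other
   generators. *)
have nK : s0 n \in 'N(<<JD p>>).
  rewrite inE sub_conjg s0V gen_subG; apply/subsetP=> _ /imsetP[i /[!inE] ip ->].
  rewrite mem_conjg s0V /Defs.genD; case: eqP => [i0|/eqP]; first by rewrite sm1J (KA o1) // eq_sym.
  rewrite -lt0n => i0; have [i1|i1] := eqVneq (i : nat) 1%N; first by rewrite i1 sA1J.
  have Ei := ord_pred_natE i0; have := KA i i0 ip.
  rewrite (sA_st Ei) stJ ?s0_BC // (s0_st (i := o0)) // !st_out //=; last first.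
  - by rewrite -val_eqE /= in Ei *; move: i1; lia.
  - by rewrite -val_eqE /= in Ei *; move: i1; lia.
  - by rewrite -val_eqE /= in Ei *; move: i1; lia.
  by rewrite -val_eqE /= in Ei *; move: i1; lia.
have sub : block false p \subset <<JD p>> * <[s0 n]>.
  rewrite -norm_joinEr ?cycle_subG //; apply: block_gen => [i i0 ip|_ _ _].
    by apply: (subsetP (joing_subl _ _)); apply: KA.
  by apply: (subsetP (joing_subr _ _)); apply: cycle_id.
apply/subsetP=> w /setIP[wB wD]; case/mulsgP: (subsetP sub _ wB) => k s kK /cycleP[j Es] Ew.
have KD : <<JD p>> \subset Dset n.
  rewrite gen_subG; apply/subsetP=> _ /imsetP[i _ ->]; rewrite /Defs.genD; case: eqP => [_|/eqP].
    exact: sm1_D.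
  by rewrite -lt0n; apply: sA_D.
have sD : s \in WD n by rewrite -(groupMl s (subsetP KD _ kK : k \in WD n)) -Ew.
rewrite Ew groupMl //; move: sD; rewrite Es -(expg_mod j s0_sq) modn2.
case: (odd j); last by rewrite expg0 group1.
by rewrite expg1 => /DP[_]; rewrite nsign_s0 // ltnW.
Qed.

End SignedPermutations.

(** * Signed permutations are conjugate to their inverses *)

Section Reality.
Variable n : nat.
Implicit Types (x y z : Tn n) (v w : {perm Tn n}).

(* For the abelian group [A] generated by [g] and the central involution, the map
   [a r |-> a^-1 r], with [r] a representative of each orbit of [A], is well
   defined and conjugates [g] to its inverse. *)
Lemma BC_real g : g \in BCset n -> exists2 c, c \in BCset n &
  g ^ c = g^-1 /\ ((forall x, (g x).2 = x.2) -> forall x, (c x).2 = x.2).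
Proof.
move=> gB; have gn := BCP _ gB; pose A := <<[set g; neg_perm n]>>.
have cgn : commute g (neg_perm n).
  by apply/permP=> x; rewrite !permM !neg_permE gn.
have abA : abelian A.
  rewrite abelian_gen; apply/centsP=> a /set2P[]-> b /set2P[]->; by [|rewrite /commute cgn].
have cA a b : a \in A -> b \in A -> a * b = b * a by move=> aA bA; apply: (centsP abA).
have gA : g \in A by rewrite mem_gen ?set21.
have nA : neg_perm n \in A by rewrite mem_gen ?set22.
pose r x := odflt x [pick y in orbit 'P A x].
have r_orb x : r x \in orbit 'P A x.
  by rewrite /r; case: pickP => //= /(_ x); rewrite orbit_refl.
have r_act a x : a \in A -> r (a x) = r x.
  move=> aA; rewrite /r (_ : orbit 'P A (a x) = orbit 'P A x).
    by case: pickP => //= /(_ x); rewrite orbit_refl.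
  by apply/eqP; rewrite orbit_eq_mem; apply/imsetP; exists a.
have rr x : exists2 a, a \in A & a (r x) = x.
  have := r_orb x; rewrite orbit_sym => /orbitP[a aA E]; by exists a.
pose al x := odflt 1 [pick a in A | a (r x) == x].
have alP x : al x \in A /\ al x (r x) = x.
  rewrite /al; case: pickP => [a /andP[aA /eqP]|] //= H.
  by have [a aA E] := rr x; have := H a; rewrite aA E eqxx.
pose c x := (al x)^-1 (r x).
have cE a x : a \in A -> a (r x) = x -> c x = a^-1 (r x).
  move=> aA E; have [bA Eb] := alP x; rewrite /c; set b := al x in bA Eb *.
  have -> : b^-1 = a * b^-1 * a^-1 by rewrite (cA a) ?groupV // mulgK.
  by rewrite !permM E -{1}Eb permK.
have c_act a x : a \in A -> c (a x) = a^-1 (c x).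
  move=> aA; have [b bA Eb] := rr x; rewrite (cE (b * a) (a x)) ?groupM //.
    by rewrite (cE b x) // r_act // cA // invMg permM.
  by rewrite r_act // permM Eb.
have nV : (neg_perm n)^-1 = neg_perm n.
  apply/eqP; rewrite eq_invg_mul; apply/eqP/permP=> y.
  by rewrite permM !neg_permE perm1 negTK.
have cn x : c (negT x) = negT (c x) by rewrite -neg_permE c_act // nV neg_permE.
have rrr x : r (r x) = r x.
  by have [a aA Ea] := rr x; rewrite -[in RHS]Ea r_act.
have cr x : c (r x) = r x by rewrite (cE 1) ?group1 // ?invg1 perm1 rrr.
have cc x : c (c x) = x.
  have [a aA Ea] := rr x.
  by rewrite (cE a x aA Ea) c_act ?groupV // invgK cr.
exists (perm (can_inj cc)); first by apply/BCP=> x; rewrite !permE.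
have cV : (perm (can_inj cc))^-1 = perm (can_inj cc).
  by apply/eqP; rewrite eq_invg_mul; apply/eqP/permP=> x; rewrite permM !permE cc.
split.
  apply/permP=> x; rewrite conjgE cV !permM [perm _ (g _)]permE [perm _ x]permE c_act //.
  by rewrite cc.
(* If [g] preserves signs, each element of [A] changes all signs or none. Hence [a] and its inverse
   change the sign of [r x] alike, and [c x] has the sign of [x]. *)
move=> g2; pose B := [set a : {perm Tn n} | [exists s : bool, [forall x, (a x).2 == s (+) x.2]]].
have gB' : group_set B.
  apply/group_setP; split=> [|a b]; rewrite !inE.
    by apply/existsP; exists false; apply/forallP=> x; rewrite perm1.
  case/existsP=> s /forallP Hs /existsP[t /forallP Ht]; apply/existsP; exists (t (+) s).
  by apply/forallP=> x; rewrite permM (eqP (Ht _)) (eqP (Hs _)) addbA.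
have AB : A \subset Group gB'.
  rewrite gen_subG; apply/subsetP=> a /set2P[]->; rewrite inE; apply/existsP.
    by exists false; apply/forallP=> x; rewrite g2.
  by exists true; apply/forallP=> x; rewrite neg_permE.
move=> x; rewrite permE; have [a aA Ea] := rr x; rewrite (cE a x aA Ea).
have := subsetP AB a aA; rewrite inE => /existsP[s /forallP Hs].
have E1 := eqP (Hs (a^-1 (r x))); rewrite permKV in E1.
by have E2 := eqP (Hs (r x)); rewrite Ea in E2; rewrite E2 E1 addKb.
Qed.
End Reality.

(** * The base function of a triple and its stabilizer *)

Section BaseFunctions.
Variable n : nat.
Implicit Types (x y z : Tn n) (v w : {perm Tn n}) (p k : nat) (f : {ffun Tn n -> Tn n}).

Lemma Tn_eq x y : x.1 = y.1 :> nat -> x.2 = y.2 -> x = y.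
Proof. by case: x y => i a [j b] /= /val_inj -> ->. Qed.

(** Indices count from 0, so the factors of [zmin] exchange [2i] and [2i + 1]. *)
Definition partner (i : nat) : nat := if odd i then i.-1 else i.+1.

Lemma partnerK i : partner (partner i) = i.
Proof. by rewrite /partner; case: i => //= i; case oi: (odd i); rewrite /= ?oi. Qed.

Lemma partner_neq i : partner i != i.
Proof. by rewrite /partner; case: ifP => oi; lia. Qed.

Lemma partner_lt i k : (i < 2 * k)%N -> (partner i < 2 * k)%N.
Proof. by rewrite /partner; case: ifP => oi; lia. Qed.

Lemma sA_sign (i : 'I_n) x : (0 < i)%N -> (sA n i x).2 = x.2.
Proof.
move=> i0; have /blockP[_ _ H] : sA n i \in block n true 0 by apply: sA_block; rewrite -?lt0n.
exact: H.
Qed.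

Lemma sA_idx (i : 'I_n) x : (0 < i)%N ->
  (sA n i x).1 = (if x.1 == i.-1 :> nat then nat_of_ord i else if x.1 == i :> nat then i.-1 else x.1) :> nat.
Proof.
move=> i0; have Ei := ord_pred_natE i0; rewrite (sA_st Ei).
have BC := st_BC (ord_pred_nat i, false) (i, false).
rewrite (BC_fst_eq BC (y := (x.1, false))) // stE -!pair_eqE /= !andbT !andbF /= -!val_eqE /=.
by case: ifP => // _; case: ifP.
Qed.

Lemma zminE k x : (2 * k <= n)%N -> (zmin n k x).2 = x.2 /\
  (zmin n k x).1 = (if x.1 < 2 * k then partner x.1 else x.1)%N :> nat.
Proof.
elim: k x => [|k IHk] x kn; first by rewrite /zmin big_ord0 perm1.
have [] := IHk x; first lia.
rewrite /zmin big_ord_recr /= -/(zmin n k) permM => E2 E1.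
have lt_i : (2 * k + 1 < n)%N by lia.
rewrite -[(2 * k + 1)%N]/(nat_of_ord (Ordinal lt_i)) sA_sign ?sA_idx //=; try lia.
split=> //; rewrite E1 /partner.
case o: (odd x.1); case: (ltnP x.1 (2 * k)) => h1; case: (ltnP x.1 (2 * k.+1)) => h2;
  repeat (case: ifP => ?); lia.
Qed.

(* The function attached to the trivial coset of the centralizer of [zmin n k]. *)
Definition base k : {ffun Tn n -> Tn n} :=
  [ffun x : Tn n => if (x.1 < 2 * k)%N then zmin n k x else (x.1, false)].

Lemma zmin_BC k : (2 * k <= n)%N -> zmin n k \in BCset n.
Proof.
move=> kn; apply: (group_prod (G := WBC n)) => i _.
have lt_i : (2 * i + 1 < n)%N by have := ltn_ord i; lia.
rewrite -[(2 * i + 1)%N]/(nat_of_ord (Ordinal lt_i)).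
by apply: (subsetP (block_BC _ true 0)); apply: sA_block => /=; lia.
Qed.

Lemma zmin_sq k : (2 * k <= n)%N -> zmin n k * zmin n k = 1.
Proof.
move=> kn; apply/permP=> x; rewrite permM perm1.
have [E2 E1] := zminE x kn; have [F2 F1] := zminE (zmin n k x) kn.
apply: Tn_eq; rewrite ?F2 // F1 E1; case: (ltnP x.1 (2 * k)) => h.
  by rewrite partner_lt // partnerK.
by rewrite ltnNge h.
Qed.

Definition commutes (f : {ffun Tn n -> Tn n}) w := [forall x, f (w x) == w (f x)].

Lemma commutesP f w : reflect (forall x, f (w x) = w (f x)) (commutes f w).
Proof. by apply: (iffP forallP) => H x; apply/eqP. Qed.

Definition signed (b : bool) : {group {perm Tn n}} := if b then block_group n true 0 else WBC n.

Lemma signedP (b : bool) w : reflect (w \in BCset n /\ (b -> forall x, (w x).2 = x.2)) (w \in signed b).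
Proof.
case: b; last by apply: (iffP idP) => [|[]].
apply: (iffP (blockP _ _ _)) => [[H1 _ H2]|[H1 H2]]; split=> // *; [exact: H2|exact: H2].
Qed.

Lemma base_fst k x : (2 * k <= n)%N -> ((base k x).1 == x.1) = (2 * k <= x.1)%N.
Proof.
move=> kn; rewrite ffunE -val_eqE; have [_ E1] := zminE x kn; case: ltnP E1 => h /= E1; last by rewrite eqxx.
by rewrite E1; apply/negbTE/partner_neq.
Qed.

(** [base n k] changes the index exactly below [2 * k], where it is [zmin], so commuting with it
    forces the block structure and the commutation with [zmin]. Beyond, it selects the positive
    point, so commuting there means preserving signs. *)
Lemma cent_zminE (b : bool) k : (2 * k <= n)%N ->
  'C_(block n b (2 * k))[zmin n k] = [set w in signed b | commutes (base k) w].
Proof.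
move=> kn; apply/setP=> w; apply/setIP/setIdP => [[/blockP[wB w1 w2] /cent1P zw]|].
  have wz x : w (zmin n k x) = zmin n k (w x) by rewrite -!permM zw.
  split; first by apply/signedP; split=> // b1 x; rewrite w2 ?b1.
  apply/commutesP=> x; rewrite !ffunE w1; case: ltnP => h; first by rewrite wz.
  have := w2 (x.1, false); rewrite h orbT => /(_ isT).
  by move=> pos; apply: Tn_eq => //=; congr nat_of_ord; apply: BC_fst_eq.
case=> /signedP[wB ws] /commutesP cw.
have w1 x : ((w x).1 < 2 * k)%N = (x.1 < 2 * k)%N.
  rewrite !ltnNge -!base_fst // cw; congr (~~ _); apply/eqP/eqP => [/(BC_fst_inj wB)//|E].
  exact: BC_fst_eq.
split; last first.
  apply/cent1P/permP=> x; rewrite !permM; have := cw x; rewrite !ffunE w1; case: ltnP => h // _.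
  have fixz y : (2 * k <= y.1)%N -> zmin n k y = y.
    move=> hy; have [E2 E1] := zminE y kn; apply: Tn_eq => //.
    by rewrite E1 ltnNge hy.
  by rewrite !fixz // leqNgt w1 -leqNgt.
apply/blockP; split=> // x /orP[/ws //|hx].
have pos : (w (x.1, false)).2 = false.
  have := cw (x.1, false); rewrite !ffunE w1 /= ltnNge hx /= => <-; by [].
have [Ex|Ex] := eq_fst (x := x) (y := (x.1, false)) erefl; rewrite Ex ?(BCP _ wB) //=.
by rewrite pos.
Qed.

End BaseFunctions.

(** * Orbits of model functions *)

Section ModelFunctions.
Variables (n : nat) (b : bool).
Implicit Types (x y z a : Tn n) (v w g : {perm Tn n}) (p k : nat) (f : {ffun Tn n -> Tn n}) (q : seq (Tn n)).

Definition posU : {set Tn n} := [set x | b ==> ~~ x.2].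

(** For [g = 1] the commutation is vacuous, so these are all the model functions; [sol_mods]
    restores a general [g]. *)
Definition mods := sol (@negT n) 1 posU false setT.

Lemma posU_cov x : (x \in posU) || (negT x \in posU).
Proof. by rewrite !inE /=; case: (b) (x.2) => [] []. Qed.

Lemma posU_all x y : x \in posU -> negT x \in posU -> y \in posU.
Proof. by rewrite !inE /=; case: (b) (x.2) => [] []. Qed.

Lemma posU_false (i : 'I_n) : (i, false) \in posU.
Proof. by rewrite inE /= implybT. Qed.

Lemma pmE x y : pm (@negT n) x y = (y.1 == x.1).
Proof.
apply/orP/eqP => [[]/eqP->//|/eq_fst[]->]; [by left | by right].
Qed.

Lemma signed_posU w x : w \in signed n b -> (w x \in posU) = (x \in posU).
Proof. by move/signedP=> [_ H]; rewrite !inE; case: (b) H => //= ->. Qed.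

Lemma signed_neg w x : w \in signed n b -> w (negT x) = negT (w x).
Proof. by move/signedP=> [/BCP]. Qed.

Lemma mem_signed w : w \in BCset n -> (forall x, x \in posU -> w x \in posU) -> w \in signed n b.
Proof.
move=> wB H; apply/signedP; split=> // bT x; have wn := BCP _ wB.
have pos y : y.2 = false -> (w y).2 = false.
  by move=> y0; have := H y; rewrite !inE bT y0 => /(_ isT)/negbTE.
case E : x.2; last exact: pos.
by have := pos (negT x); rewrite wn /= E => /(_ erefl)/negbFE.
Qed.

Lemma modsP f : reflect (forall x, (x \in posU -> f x \in posU) /\
   (if (f x).1 == x.1 then f (negT x) = f x else f (f x) = x /\ f (negT x) = negT (f x)))
  (f \in mods).
Proof.
apply: (iffP idP) => [/sol_memP[H _] x|H].
  have [_ /and3P[_ /implyP Hu]] := H x (in_setT _); rewrite pmE => Hx; split=> //.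
  by case: ifP Hx => _ => [/eqP|/andP[/eqP ? /eqP ?]].
apply/sol_memP; split=> x; rewrite in_setT // => _; split=> //.
have [Hu Hx] := H x; apply/and3P; split; [by rewrite !perm1 | exact/implyP|].
rewrite pmE; case: ifP Hx => _ [->]; rewrite ?eqxx //.
by move=> ->; rewrite eqxx.
Qed.

Lemma sol_mods g f : (f \in sol (@negT n) g posU false setT) = (f \in mods) && commutes f g.
Proof.
apply/sol_memP/andP => [[H _]|[/sol_memP[H _] /forallP cg]].
  split; last by apply/forallP=> x; have [_ /and3P[]] := H x (in_setT _).
  apply/sol_memP; split=> x; rewrite in_setT // => _; split=> //.
  by have [_ /and3P[_ h2 h3]] := H x (in_setT _); rewrite /sol_at !perm1 eqxx h2.
split=> x; rewrite in_setT // => _; split=> //.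
by have [_ /and3P[_ h2 h3]] := H x (in_setT _); rewrite /sol_at cg h2.
Qed.

Lemma mods_pos f x : f \in mods -> x \in posU -> f x \in posU.
Proof. by move=> /modsP/(_ x)[]. Qed.

Lemma mods_proj f x : f \in mods -> (f x).1 == x.1 -> f (negT x) = f x.
Proof. by move=> /modsP/(_ x)[_]; case: ifP. Qed.

Lemma mods_inv f x : f \in mods -> (f x).1 != x.1 -> f (f x) = x.
Proof. by move=> /modsP/(_ x)[_]; case: ifP => // _ []. Qed.

Lemma mods_neg f x : f \in mods -> (f x).1 != x.1 -> f (negT x) = negT (f x).
Proof. by move=> /modsP/(_ x)[_]; case: ifP => // _ []. Qed.

Lemma mods_fst f x y : f \in mods -> x.1 = y.1 -> (f x).1 = (f y).1.
Proof.
move=> fM /eq_fst[->//|->]; have [E|E] := boolP ((f y).1 == y.1).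
  by rewrite (mods_proj fM E).
by rewrite (mods_neg fM E).
Qed.

Lemma base_mods k : (2 * k <= n)%N -> base n k \in mods.
Proof.
move=> kn; apply/modsP=> x; split.
  move=> xU; rewrite ffunE; case: ifP => _; last exact: posU_false.
  by move: xU; rewrite !inE; have [-> _] := zminE x kn.
rewrite base_fst // !ffunE /=; have [_] := zminE x kn; case: leqP => h E1 //.
rewrite E1 partner_lt // -permM zmin_sq // perm1; split=> //.
by rewrite (BCP _ (zmin_BC kn)).
Qed.

(** Entries at positions [2i] and [2i + 1] are exchanged by [f], just as [zmin] exchanges these
    indices. *)
Definition pairing f q := flatten [seq [:: a; f a] | a <- q].

Lemma mem_pairing f q y : y \in pairing f q -> exists2 a, a \in q & y = a \/ y = f a.
Proof.
case/flatten_mapP=> a aq; rewrite !inE => /orP[]/eqP->; exists a => //; by [left | right].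
Qed.

Lemma pairing_exists f : f \in mods -> exists q,
  [/\ uniq (map fst (pairing f q)), all (mem posU) (pairing f q),
      {in q, forall a, (f a).1 != a.1} &
      forall x, (f x).1 != x.1 -> x.1 \in map fst (pairing f q)].
Proof.
move=> fM; pose good q := [/\ uniq (map fst (pairing f q)), all (mem posU) (pairing f q) &
      {in q, forall a, (f a).1 != a.1}].
pose maximal q := forall x, (f x).1 != x.1 -> x.1 \in map fst (pairing f q).
(* Greedy extension: the indices in the list are distinct, so its length is at most [n], and each
   new couple lowers the measure. *)
suff H N q : (n - size (pairing f q) < N)%N -> good q -> exists q', good q' /\ maximal q'.
  by have [||q [[]]] := H n.+1 [::]; rewrite ?ltnS ?leq_subr //; exists q.
elim: N q => // N IHN q ltN [uq aq mq].
pose free x := ((f x).1 != x.1) && (x.1 \notin map fst (pairing f q)).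
have [/existsP[x0 /andP[mx0 nx0]]|] := boolP [exists x, free x]; last first.
  rewrite negb_exists => /forallP H; exists q; split=> // x mx.
  by have := H x; rewrite /free mx negbK.
have [x [mx nx xU]] : exists x, [/\ (f x).1 != x.1, x.1 \notin map fst (pairing f q) & x \in posU].
  have /orP[x0U|x0U] := posU_cov x0; [by exists x0 | exists (negT x0); split=> //].
  by rewrite (mods_fst fM (y := x0)).
have nfx : (f x).1 \notin map fst (pairing f q).
  apply: contra nx => /mapP[y yl E]; have ffx := mods_inv fM mx.
  have Ey : x.1 = (f y).1 by rewrite -(mods_fst fM E) ffx.
  rewrite Ey; apply: map_f; have [a aq' [->|->]] := mem_pairing yl.
    by apply/flatten_mapP; exists a; rewrite // !inE eqxx orbT.
  by rewrite (mods_inv fM (mq a aq')); apply/flatten_mapP; exists a; rewrite // !inE eqxx.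
have good' : good (x :: q).
  split=> /=; rewrite ?xU ?(mods_pos fM) //.
    by rewrite inE negb_or eq_sym mx nx nfx.
  by move=> a; rewrite inE => /orP[/eqP->|/mq].
apply: IHN (good'); have [/card_uniqP E _ _] := good'.
have := max_card (mem (map fst (pairing f (x :: q)))).
rewrite E size_map card_ord; move: ltN; rewrite /pairing /=; move: (size _) => s; lia.
Qed.

Lemma size_pairing f q : size (pairing f q) = (2 * size q)%N.
Proof. by rewrite /pairing; elim: q => //= a q ->; lia. Qed.

Lemma nth_pairing f q x0 i : {in q, forall a, f (f a) = a} -> (i < size (pairing f q))%N ->
  nth x0 (pairing f q) (partner i) = f (nth x0 (pairing f q) i).
Proof.
elim: q i => // a q IHq i ff; case: i => [|[|i]] //= => [_|lt_i]; first by rewrite ff ?mem_head.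
have -> : partner i.+2 = (partner i).+2.
  by rewrite /partner /= negbK; case: ifP => //; case: i {lt_i}.
by apply: IHq => // c cq; apply: ff; rewrite inE cq orbT.
Qed.

(** The list [L] contains the couples exchanged by [f], then the chosen point of each remaining
    pair: [n] points of [U] with distinct indices. Sending the [i]-th positive point to the [i]-th
    entry of [L] carries [base n k] to [f], where [k] is the number of couples. *)
Lemma mods_transitive f : f \in mods -> exists2 k, (2 * k <= n)%N &
  exists2 w, w \in signed n b & forall x, f (w x) = w (base n k x).
Proof.
move=> fM; have [q [uq aq mq cq]] := pairing_exists fM.
set l := pairing f q in uq aq cq; pose N := [seq i <- enum 'I_n | i \notin map fst l].
pose l2 := [seq f (i, false) | i <- N]; pose L := l ++ l2.
have Nfix i : i \in N -> (f (i, false)).1 = i.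
  rewrite mem_filter => /andP[il _]; apply/eqP; apply: contraR il => H.
  exact: (cq (i, false)).
have fstL : map fst L = map fst l ++ N.
  rewrite map_cat -map_comp; congr (_ ++ _); rewrite -[RHS]map_id.
  exact/eq_in_map.
have uL : uniq (map fst L).
  rewrite fstL cat_uniq uq filter_uniq ?enum_uniq // andbT.
  by apply/hasPn=> i; rewrite mem_filter => /andP[].
have sL : size L = n.
  rewrite -(size_map fst) -[RHS]size_enum_ord; apply/perm_size/uniq_perm => //; first exact: enum_uniq.
  move=> i; rewrite mem_enum fstL mem_cat mem_filter mem_enum andbT.
  by case: (i \in map fst l).
have sl : size l = (2 * size q)%N by apply: size_pairing.
pose s (i : 'I_n) := nth (i, false) L i.
have sE (i : 'I_n) d : s i = nth d L i by apply: set_nth_default; rewrite sL.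
have s_inj i j : (s i).1 = (s j).1 -> i = j.
  rewrite (sE j (i, false)) /s => E; apply/val_inj/eqP.
  rewrite -(nth_uniq i (s := map fst L)) ?size_map ?sL ?ltn_ord //.
  by rewrite !(nth_map (i, false)) ?sL ?ltn_ord //; apply/eqP.
pose w0 x := if x.2 then negT (s x.1) else s x.1.
have w0_inj : injective w0.
  case=> i e [j e'] E; have ij : i = j.
    by apply: s_inj; have := congr1 fst E; rewrite /w0 /=; case: (e) (e') => [] [].
  move: E; rewrite ij /w0 /=; case: e e' => [] [] // /eqP; first by rewrite (negbTE (negT_neq _)).
  by rewrite eq_sym (negbTE (negT_neq _)).
have sU i : s i \in posU.
  have : s i \in L by rewrite /s mem_nth ?sL.
  rewrite mem_cat => /orP[/(allP aq)//|/mapP[j _ ->]].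
  by rewrite mods_pos ?posU_false.
have kn : (2 * size q <= n)%N by rewrite -sl -[X in (_ <= X)%N]sL size_cat leq_addr.
exists (size q) => //; exists (perm w0_inj).
  apply: mem_signed => [|x xU].
    by apply/BCP=> x; rewrite !permE /w0 /=; case: x.2; rewrite ?negTK.
  rewrite permE /w0; case E: x.2; rewrite ?sU //.
  by move: xU; rewrite !inE E; case: (b).
move=> x; rewrite !permE [base _ _ _]ffunE.
case: ltnP => hx.
  have sx : s x.1 = nth (x.1, false) l x.1 by rewrite /s nth_cat sl hx.
  have [a aq' Ha] : exists2 a, a \in q & s x.1 = a \/ s x.1 = f a.
    by apply: mem_pairing; rewrite sx mem_nth ?sl.
  have mx : (f (s x.1)).1 != (s x.1).1.
    case: Ha => ->; first exact: mq.
    by rewrite (mods_inv fM (mq _ aq')) eq_sym; exact: mq.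
  have [E2 E1] := zminE x kn; rewrite hx in E1.
  have fs : f (s x.1) = s (zmin n (size q) x).1.
    rewrite sx -nth_pairing ?sl //; last by move=> c cq'; rewrite (mods_inv fM) ?mq.
    by rewrite -/l (sE _ (x.1, false)) E1 nth_cat sl partner_lt.
  rewrite /w0 E2; case: x.2; rewrite ?fs //.
  by rewrite (mods_neg fM) // fs.
have [j jN Ej] : exists2 j, j \in N & s x.1 = f (j, false).
  apply/mapP; rewrite /s nth_cat sl ltnNge hx /= mem_nth //.
  by rewrite -(ltn_add2l (2 * size q)) subnKC // -sl -size_cat -/L sL.
have fs : f (s x.1) = s x.1.
  rewrite Ej; have pj : (f (j, false)).1 == (j, false).1 by rewrite Nfix.
  have [E|E] := eq_fst (x := f (j, false)) (y := (j, false)) (eqP pj); first by rewrite !E.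
  by rewrite {1}E (mods_proj fM pj).
rewrite /w0 /=; case: x.2; rewrite ?fs //.
by rewrite (mods_proj fM) fs.
Qed.

Definition conjf f w : {ffun Tn n -> Tn n} := [ffun x : Tn n => w^-1 (f (w x))].

Lemma conjfM f v w : conjf (conjf f v) w = conjf f (w * v).
Proof. by apply/ffunP=> x; rewrite !ffunE invMg !permM. Qed.

Lemma conjf1 f : conjf f 1 = f.
Proof. by apply/ffunP=> x; rewrite ffunE invg1 !perm1. Qed.

Lemma commutes_conj f g w : commutes f (g ^ w) = commutes (conjf f w) g.
Proof.
apply/commutesP/commutesP=> H x.
  have E := H (w x); rewrite permJ in E; rewrite !ffunE; apply: (@perm_inj _ w); rewrite permKV E.
  by rewrite conjgE !permM.
have := H (w^-1 x); rewrite !ffunE permKV => E.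
by rewrite conjgE !permM -E permKV.
Qed.

Lemma conjf_id f w : (conjf f w == f) = commutes f w.
Proof.
apply/eqP/commutesP=> [E x|H]; last by apply/ffunP=> x; rewrite ffunE H permK.
by rewrite -{2}E ffunE permKV.
Qed.

Lemma conjf_mods f w : f \in mods -> w \in signed n b -> conjf f w \in mods.
Proof.
move=> fM wS; have wVS : w^-1 \in signed n b by rewrite groupV.
have [wB _] := signedP _ _ wS; have [wVB _] := signedP _ _ wVS.
apply/modsP=> x; split=> [xU|].
  by rewrite ffunE signed_posU // mods_pos // signed_posU.
rewrite !ffunE permKV (signed_neg _ wS).
have -> : ((w^-1 (f (w x))).1 == x.1) = ((f (w x)).1 == (w x).1).
  apply/eqP/eqP=> [E|E]; last by rewrite (BC_fst_eq wVB E) permK.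
  by apply: (BC_fst_inj wVB); rewrite permK.
case: ifP => [E|/negbT E]; first by rewrite (mods_proj fM E).
by rewrite (mods_inv fM E) permK (mods_neg fM E) (signed_neg _ wVS).
Qed.

Lemma sg_conj f g w : sg (g ^ w) (fixin f setT) = sg g (fixin (conjf f w) setT).
Proof.
have -> : fixin f setT = w @: fixin (conjf f w) setT.
  apply/setP=> x; rewrite -[x](permKV w) (mem_imset _ _ perm_inj) !mem_fixin !in_setT ffunE permKV.
  by rewrite (inj_eq perm_inj).
rewrite /sg (card_imset _ perm_inj) -imset_comp; congr ((-1) ^+ (_ + _))%R.
rewrite -[RHS](card_imset _ (imset_inj (@perm_inj _ w))) -imset_comp; congr #|pred_of_set _|.
apply: eq_imset => x /=; apply/setP=> y; rewrite -[y](permKV w) (mem_imset _ _ perm_inj).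
by apply/porbitP/porbitP=> -[i E]; exists i; move: E; rewrite -conjXg permJ; [move/perm_inj | move->].
Qed.

(** A conjugation invariant which separates the orbits of [base n k] for different [k]. *)
Definition moved f := #|[set x : Tn n | (f x).1 != x.1]|.

Lemma moved_conj f w : w \in BCset n -> moved (conjf f w) = moved f.
Proof.
move=> wB; rewrite /moved -(card_imset _ (@perm_inj _ w)); congr #|pred_of_set _|.
have wVB : w^-1 \in BCset n by rewrite (groupV (WBC n)).
apply/setP=> x; rewrite -[x](permKV w) (mem_imset _ _ perm_inj) !inE ffunE permKV; congr (~~ _).
apply/eqP/eqP=> [E|E]; last by rewrite (BC_fst_eq wVB E).
exact: (BC_fst_inj wVB).
Qed.

Lemma moved_base k l : (2 * k <= n)%N -> (2 * l <= n)%N -> moved (base n k) = moved (base n l) -> k = l.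
Proof.
wlog kl : k l / (k <= l)%N.
  by move=> H kn ln E; case/orP: (leq_total k l) => [/H|/H H']; [|apply/esym]; auto.
move=> kn ln E; apply/eqP; rewrite eqn_leq kl leqNgt; apply/negP=> lt_kl.
move/eqP: E; rewrite ltn_eqF //; apply: proper_card.
have lt_n : (2 * k < n)%N by lia.
rewrite properE; apply/andP; split.
  by apply/subsetP=> x; rewrite !inE !base_fst //; lia.
by apply/subsetPn; exists (Ordinal lt_n, false); rewrite !inE base_fst //= ?leqnn // -ltnNge; lia.
Qed.

Definition stab k := [set w in signed n b | commutes (base n k) w].
Definition orbit_base k := [set conjf (base n k) w | w in signed n b].

Lemma card_fibre k f : f \in orbit_base k ->
  #|[set w in signed n b | conjf (base n k) w == f]| = #|stab k|.
Proof.
case/imsetP=> v vS ->; rewrite -(card_lcoset (stab k) v); congr #|pred_of_set _|.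
apply/setP=> w; rewrite mem_lcoset !inE groupMl ?groupV //; congr (_ && _).
rewrite -conjf_id -conjfM; apply/eqP/eqP=> [->|E]; first by rewrite conjfM mulVg conjf1.
by rewrite -[in RHS]E conjfM mulgV conjf1.
Qed.

Lemma stab_gt0 k : (0 < #|stab k|)%N.
Proof.
apply/card_gt0P; exists 1; rewrite inE group1; apply/commutesP=> x.
by rewrite !perm1.
Qed.

(** Orbit-stabilizer: each function in the orbit of [base n k] arises from [#|stab k|] elements [w].
    The orbits exhaust [mods] by [mods_transitive] and are disjoint by [moved_base]. *)
Lemma sum_orbits (F : {ffun Tn n -> Tn n} -> algC) :
  (\sum_(k < n./2.+1) #|stab k|%:R^-1 * \sum_(w in signed n b) F (conjf (base n k) w) =
   \sum_(f in mods) F f)%R.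
Proof.
have kn (k : 'I_n./2.+1) : (2 * k <= n)%N by have := ltn_ord k; lia.
transitivity (\sum_(k < n./2.+1) \sum_(f in mods | f \in orbit_base k) F f)%R.
  apply: eq_bigr => k _.
  rewrite (partition_big (conjf (base n k)) (mem (orbit_base k))) /=; last by move=> w wS; apply: imset_f.
  rewrite mulr_sumr; apply: eq_big => [f|f fO].
    rewrite andb_idl // => /imsetP[w wS ->]; apply: conjf_mods wS; exact: base_mods.
  rewrite (eq_bigr (fun _ => F f)) => [|w /andP[_ /eqP->] //].
  rewrite (eq_bigl (mem [set w in signed n b | conjf (base n k) w == f])) => [|w]; last by rewrite /= in_set.
  by rewrite sumr_const card_fibre // -[(F f *+ _)%R]mulr_natl mulKf // pnatr_eq0 -lt0n stab_gt0.
rewrite (exchange_big_dep (mem mods)) /=; last by move=> k f _ /andP[].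
apply: eq_bigr => f fM; have [k0 k0n [w wS Ew]] := mods_transitive fM.
have k0_lt : (k0 < n./2.+1)%N by lia.
have fk0 : f \in orbit_base k0.
  apply/imsetP; exists w^-1; rewrite ?groupV //; apply/ffunP=> x.
  by rewrite ffunE invgK -Ew permKV.
rewrite (big_pred1 (Ordinal k0_lt)) // => k /=; rewrite fM /=; apply/idP/eqP=> [|->//].
case/imsetP: fk0 => v vS ->; case/imsetP=> u uS E; apply/val_inj/moved_base => //=.
have [vB _] := signedP _ _ vS; have [uB _] := signedP _ _ uS.
by rewrite -(moved_conj _ uB) -E moved_conj.
Qed.

(** [f (f x) = g x] makes [f] injective, hence a permutation; the conditions on [negT] and [posU]
    then place it in [signed n b]. *)
Lemma card_roots g : g \in signed n b ->
  #|sol (@negT n) g posU true setT| = #|[set x in signed n b | x * x == g]|.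
Proof.
move=> gS; pose h w : {ffun Tn n -> Tn n} := [ffun x => w x].
have h_inj : injective h by move=> v w E; apply/permP=> x; have /ffunP/(_ x) := E; rewrite !ffunE.
rewrite -[RHS](card_imset _ h_inj); congr #|pred_of_set _|; apply/setP=> f.
apply/sol_memP/imsetP=> [[H _]|[w /setIdP[wS /eqP <-] ->]]; last first.
  split=> x; rewrite in_setT // => _; split=> //; rewrite /sol_at !ffunE !permM.
  by rewrite (signed_neg _ wS) (signed_posU _ wS) implybb !eqxx.
have ff x : f (f x) = g x by have [_ /and3P[_ _ /andP[/eqP]]] := H x (in_setT _).
have fn x : f (negT x) = negT (f x) by have [_ /and3P[_ _ /andP[_ /eqP]]] := H x (in_setT _).
have f_inj : injective f by move=> x y E; apply: (@perm_inj _ g); rewrite -!ff E.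
exists (perm f_inj); last by apply/ffunP=> x; rewrite ffunE permE.
apply/setIdP; split; last by apply/eqP/permP=> x; rewrite permM !permE.
apply: mem_signed => [|x xU]; first by apply/BCP=> x; rewrite !permE.
by rewrite permE; have [_ /and3P[_ /implyP H2 _]] := H x (in_setT _); apply: H2.
Qed.

(** Conjugating [g] against a fixed [base n k] amounts to fixing [g] and moving the function through
    its orbit; then [sum_orbits] and [signed_count] apply. *)
Theorem model_sum_roots g : g \in signed n b ->
  (\sum_(k < n./2.+1) #|stab k|%:R^-1 * \sum_(w in signed n b)
      (if commutes (base n k) (g ^ w) then sg (g ^ w) (fixin (base n k) setT) else 0) =
   #|[set x in signed n b | (x * x)%g == g]|%:R)%R.
Proof.
move=> gS; pose F f := (if commutes f g then sg g (fixin f setT) else 0)%R : algC.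
have stT : stable (@negT n) g setT by move=> x; split; rewrite !in_setT.
rewrite -card_roots // -(signed_count (@negTK n) (@negT_neq n) (fun x => signed_neg x gS)
  (fun x => signed_posU x gS) posU_cov posU_all stT).
have E w k : (if commutes (base n k) (g ^ w) then sg (g ^ w) (fixin (base n k) setT) else 0)%R =
    F (conjf (base n k) w) by rewrite /F commutes_conj sg_conj.
transitivity (\sum_(f in mods) F f)%R.
  rewrite -(sum_orbits F).
  apply: eq_bigr => k _.
  apply: congr1.
  apply: eq_bigr => w _.
  exact: E.
rewrite -big_mkcondr; apply: eq_bigl => f; exact/esym/sol_mods.
Qed.

End ModelFunctions.

(** * Signs *)

(** The restricted permutation has the cycles of [w] inside [Q] and one singleton for each point
    outside, and these singletons cancel the points outside in the parity. *)
Lemma sg_restr_perm (X : finType) (Q : {set X}) (w : {perm X}) :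
  (forall x, (w x \in Q) = (x \in Q)) -> ((-1) ^+ odd_perm (restr_perm Q w) = sg w Q)%R.
Proof.
move=> wQ; have wN : w \in 'N(Q | 'P) by apply/astabsP=> x; rewrite /= apermE wQ.
set r := restr_perm Q w; have rQ x : x \in Q -> r x = w x by move=> xQ; rewrite /r restr_permE.
have rC x : x \notin Q -> r x = x by move=> xQ; apply: (out_perm (restr_perm_on Q w)).
have iterQ x i : x \in Q -> (r ^+ i) x = (w ^+ i) x /\ (w ^+ i) x \in Q.
  move=> xQ; elim: i => [|i [IH1 IH2]]; first by rewrite !expg0 !perm1.
  by rewrite !expgSr !permM IH1 rQ // wQ.
have porbQ x : x \in Q -> porbit r x = porbit w x.
  by move=> xQ; apply/setP=> y; apply/porbitP/porbitP=> -[i ->]; exists i; have [] := iterQ x i xQ.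
have porbC x : x \notin Q -> porbit r x = [set x].
  move=> xQ; apply/setP=> y; rewrite inE; apply/porbitP/eqP=> [[i ->]|->].
    by elim: i => [|i IH]; rewrite ?expg0 ?perm1 // expgSr permM IH rC.
  by exists 0%N; rewrite expg0 perm1.
have E : porbits r = porbit w @: Q :|: (set1 @: (~: Q)).
  apply/setP=> O; apply/imsetP/setUP=> [[x _ ->]|[]/imsetP[x xQ ->]].
  - have [xQ|xQ] := boolP (x \in Q); [left; rewrite porbQ // | right; rewrite porbC //]; apply: imset_f => //.
    by rewrite inE.
  - by exists x; rewrite ?porbQ.
  by exists x; rewrite ?porbC //; rewrite inE in xQ.
have dis : porbit w @: Q :&: (set1 @: (~: Q)) = set0.
  apply/eqP; rewrite setI_eq0; apply/pred0P=> O /=; apply/negP=> /andP[/imsetP[x xQ ->]].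
  case/imsetP=> y; rewrite inE => yQ E1; have := porbit_id w x; rewrite E1 inE => /eqP xy.
  by rewrite -xy xQ in yQ.
rewrite /sg -[in RHS]signr_odd oddD; congr ((-1) ^+ nat_of_bool _)%R.
rewrite /odd_perm /= E cardsU dis cards0 subn0.
rewrite (card_imset _ set1_inj) -(cardsC Q) !oddD.
by case: (odd #|Q|); case: (odd #|~: Q|); case: (odd _).
Qed.

Section QuotientSign.
Variables (n p : nat).
Implicit Types (v w : {perm Tn n}) (i j : 'I_n).

Definition idx w i : 'I_n := (w (i, false)).1.
Definition tail_pairs : {set 'I_n * 'I_n} := [set ij : 'I_n * 'I_n | (p <= ij.1)%N && (ij.1 < ij.2)%N].
Definition invert w (ij : 'I_n * 'I_n) : bool := (idx w ij.2 < idx w ij.1)%N.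
Definition tail : {set Tn n} := [set x : Tn n | (p <= x.1)%N && ~~ x.2].

Lemma sigmaQE w : sigmaQ n p w = (\prod_(ij in tail_pairs) (-1) ^+ invert w ij)%R.
Proof.
rewrite /sigmaQ -prodr_const.
rewrite (eq_bigl (fun ij : 'I_n * 'I_n => (ij \in tail_pairs) && invert w ij)); last first.
  by move=> ij; rewrite !inE -andbA.
by rewrite big_mkcondr; apply: eq_bigr => ij _; case: ifP.
Qed.

Lemma idxM v w i : w \in BCset n -> idx (v * w) i = idx w (idx v i).
Proof. by move=> wB; rewrite /idx permM; apply: BC_fst_eq. Qed.

Lemma idx_inj w : w \in BCset n -> injective (idx w).
Proof. by move=> wB i j; apply: (BC_fst_inj wB). Qed.

Lemma idx_tail b w i : w \in block n b p -> (p <= idx w i)%N = (p <= i)%N.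
Proof. by case/blockP=> _ H _; rewrite leqNgt [RHS]leqNgt; have := H (i, false) => /= ->. Qed.

(** The image of a pair under [v], put back in increasing order. It permutes [tail_pairs], and an
    inversion of [v * w] is one of [v] at the pair or one of [w] at the sorted image, but not both:
    hence multiplicativity. *)
Definition sort_pair v (ij : 'I_n * 'I_n) : 'I_n * 'I_n :=
  if invert v ij then (idx v ij.2, idx v ij.1) else (idx v ij.1, idx v ij.2).

Lemma sort_pair_tail v : v \in block n false p -> sort_pair v @: tail_pairs = tail_pairs.
Proof.
move=> vH; have [vB _ _] := blockP _ _ _ vH.
have inj : {in tail_pairs &, injective (sort_pair v)}.
  move=> [i j] [k l]; rewrite !inE /= => /andP[_ ij] /andP[_ kl].
  rewrite /sort_pair; case: ifP => _; case: ifP => _ /= [] /(idx_inj vB) E1 /(idx_inj vB) E2;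
    rewrite ?E1 ?E2 //; move: ij kl; rewrite E1 E2; lia.
apply/eqP; rewrite eqEcard (card_in_imset inj) leqnn andbT; apply/subsetP=> _ /imsetP[[i j] H ->].
move: H; rewrite !inE /= => /andP[pi ij]; have pj : (p <= j)%N by lia.
rewrite /sort_pair /invert /=; case: ltnP => h /=; rewrite (idx_tail _ vH) ?pj ?pi //=.
rewrite ltn_neqAle h andbT; apply: contraL ij => /eqP E.
by rewrite (idx_inj vB (val_inj E)) ltnn.
Qed.

Lemma sigmaQM v w : v \in block n false p -> w \in block n false p ->
  (sigmaQ n p (v * w)%g = sigmaQ n p v * sigmaQ n p w)%R.
Proof.
move=> vH wH; have [vB _ _] := blockP _ _ _ vH; have [wB _ _] := blockP _ _ _ wH.
rewrite !sigmaQE -[in X in (_ = _ * X)%R](sort_pair_tail vH) big_imset /=; last first.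
  apply/imset_injP; rewrite sort_pair_tail //.
rewrite -big_split; apply: eq_bigr => -[i j]; rewrite inE /= => /andP[_ ij].
rewrite -signr_addb; congr ((-1) ^+ nat_of_bool _)%R.
rewrite /sort_pair /invert /= !idxM //; case: (ltnP (idx v j) (idx v i)) => h //=.
rewrite ltnNge leq_eqVlt; set a := idx w _; set c := idx w _.
have -> : (a == c :> nat) = false; last by [].
apply/negP=> /eqP/val_inj/(idx_inj wB)/(idx_inj vB) E; by rewrite E ltnn in ij.
Qed.

Lemma tail_stable b w : w \in block n b p -> forall x, (w x \in tail) = (x \in tail).
Proof.
case/blockP=> _ H1 H2 x; rewrite !inE leqNgt H1 -leqNgt.
by case: (boolP (p <= x.1)%N) => //= px; rewrite H2 // px orbT.
Qed.

Lemma sigmaQ_fix w : (forall i, (p <= i)%N -> w (i, false) = (i, false)) ->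
  sigmaQ n p w = 1%R /\ restr_perm tail w = 1.
Proof.
move=> H; split.
  rewrite sigmaQE big1 // => -[i j]; rewrite inE /= => /andP[pi ij].
  rewrite /invert /idx /= !H //; last by lia.
  by rewrite ltnNge ltnW.
have wN : w \in 'C(tail | 'P).
  apply/astabP=> -[i []]; rewrite inE /= ?andbF // andbT /= apermE; exact: H.
by apply/eqP; have := ker_restr_perm tail => /setP/(_ w); rewrite wN => /mker ->.
Qed.

Lemma sigmaQ_sA i : (p < i)%N -> sigmaQ n p (sA n i) = (-1)%R /\ odd_perm (restr_perm tail (sA n i)).
Proof.
move=> pi; have i0 : (0 < i)%N by apply: leq_ltn_trans pi.
have Ei := ord_pred_natE i0; split.
  rewrite /sigmaQ (_ : [set _ | _] = [set (ord_pred_nat i, i)]) ?cards1 ?expr1 //.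
  apply/setP=> -[a c]; rewrite !inE /= -pair_eqE /= -!val_eqE /= !sA_idx //=.
  by repeat case: ifP; lia.
have sH : sA n i \in block n false p by apply: sA_block => //; rewrite neq_ltn pi orbT.
have sN : sA n i \in 'N(tail | 'P) by apply/astabsP=> x; rewrite /= apermE (tail_stable sH).
have pi' : (p <= i.-1)%N by lia.
suff -> : restr_perm tail (sA n i) = tperm (ord_pred_nat i, false) (i, false).
  by rewrite odd_tperm -pair_eqE /= andbT -val_eqE /=; lia.
apply/permP=> x; have [xT|xT] := boolP (x \in tail).
  rewrite restr_permE // (sA_st Ei) stE permE /=.
  case: ifP => // h1; case: ifP => // h2; move: xT; rewrite inE => /andP[_ x2].
  by case: x x2 h1 h2 => y [] //= _ _ _; rewrite -!pair_eqE /= !andbF.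
rewrite (out_perm (restr_perm_on _ _)) // tpermD //; apply: contraNneq xT => <-; rewrite inE /=; lia.
Qed.

(** Both sides are multiplicative on the block, so it is enough to compare them on the
    generators. *)
Lemma sigmaQ_sg b w : w \in block n b p -> sigmaQ n p w = sg w tail.
Proof.
move=> wH; have {}wH : w \in block n false p.
  have /blockP[H1 H2 H3] := wH; apply/blockP; split=> // x px; apply: H3.
  by move: px => /= ->; rewrite orbT.
rewrite -sg_restr_perm; last exact: tail_stable wH.
pose K := [set w in block n false p | sigmaQ n p w == ((-1) ^+ odd_perm (restr_perm tail w))%R].
have gK : group_set K.
  apply/group_setP; split.
    rewrite inE group1 /= morph1 odd_perm1 (sigmaQ_fix _).1 // => i _; exact: perm1.
  move=> v u /setIdP[vH /eqP Ev] /setIdP[uH /eqP Eu]; apply/setIdP.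
  have N t : t \in block n false p -> t \in 'N(tail | 'P).
    by move=> tH; apply/astabsP=> x; rewrite /= apermE (tail_stable tH).
  rewrite groupM // sigmaQM // Ev Eu morphM ?N // odd_permM signr_addb; split=> //.
suff /subsetP/(_ w wH) : block n false p \subset Group gK by rewrite inE => /andP[_ /eqP].
apply: block_gen => [i i0 ip|_ p0 n0]; rewrite inE.
  rewrite sA_block //=; move: ip; rewrite neq_ltn => /orP[ip|pi].
    have Ei := ord_pred_natE i0; have fixj j : (p <= j)%N -> sA n i (j, false) = (j, false).
      by move=> pj; rewrite (sA_st Ei) st_out //=; rewrite -val_eqE /=; lia.
    by have [-> ->] := sigmaQ_fix fixj; rewrite odd_perm1.
  by have [-> ->] := sigmaQ_sA pi.
pose o := Ordinal n0; rewrite (s0_st (i := o)) // st_block //= ?p0 //; last first.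
  by rewrite leqn0 => /eqP E; move: p0; rewrite E.
have fixj j : (p <= j)%N -> st (o, false) (o, true) (j, false) = (j, false).
  by move=> pj; rewrite st_out //=; rewrite -val_eqE /=; lia.
by have [-> ->] := sigmaQ_fix fixj; rewrite odd_perm1.
Qed.

End QuotientSign.

(** * Model triples *)

Section CoxeterLength.
Variable gT : finGroupType.
Implicit Types (S : {set gT}) (w z : gT).

Definition ball S m : {set gT} := iter m (fun B => B :|: B * S) [set 1].

Lemma clen_le S w m : w \in ball S m -> clen S w <= m.
Proof.
move=> wm; rewrite leqNgt; apply/negP=> lt_m.
have lt_s : (m < #|gT|.+1)%N.
  by apply: leq_trans lt_m _; rewrite -[X in (_ <= X)%N](size_iota 0); apply: find_size.
by have := before_find 0%N lt_m; rewrite nth_iota // add0n -/(ball S m) wm.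
Qed.

(** If [z] lies in none of the balls searched, [clen S z] is the default of [find], the length of
    the list, which bounds every value of [clen]. *)
Lemma clen_le_of_ball S w z : (forall m, z \in ball S m -> clen S w <= m) -> clen S w <= clen S z.
Proof.
move=> H; have [h|h] := boolP (has (fun k => z \in ball S k) (iota 0 #|gT|.+1)).
  apply: H; have := nth_find 0%N h; rewrite nth_iota ?add0n //.
  by rewrite -[X in (_ < X)%N](size_iota 0) -has_find.
have := hasNfind h; rewrite /clen -/(ball S) => ->; exact: find_size.
Qed.

End CoxeterLength.

Section ModelTriples.
Variable n : nat.
Implicit Types (x y z : Tn n) (v w s : {perm Tn n}) (p k : nat).

Lemma stK x y : st x y * st x y = 1.
Proof.
have n1 := BCP _ (st_BC x y).
have E z : st x y z = if z == x then y else if z == y then x else if z == negT x then negT y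
  else if z == negT y then negT x else z by exact: stE.
have sx : st x y x = y by exact: stL.
have sy : st x y y = x by rewrite stC stL.
apply/permP=> z; rewrite permM perm1 (E z).
case: eqP => [->|zx]; first by rewrite sy.
case: eqP => [->|zy]; first by rewrite sx.
case: eqP => [->|znx]; first by rewrite n1 sy.
case: eqP => [->|zny]; first by rewrite n1 sx.
by rewrite E; do 4 (case: eqP => // _).
Qed.

Lemma stV x y : (st x y)^-1 = st x y.
Proof. by apply/eqP; rewrite eq_invg_mul stK. Qed.

Definition support w := [set x | w x != x].

Lemma support_st x y : #|support (st x y)| <= 4.
Proof.
have sub : support (st x y) \subset [set:: [:: x; y; negT x; negT y]].
  apply/subsetP=> z; rewrite !inE stE; case: (z =P x) => //= _; case: (z =P y) => //= _.
  by case: (z =P negT x) => //= _; case: (z =P negT y) => //= _; rewrite eqxx.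
by apply: leq_trans (subset_leq_card sub) _; rewrite cardsE; apply: card_size.
Qed.

(** A lower bound for the length: each generator moves at most four points. [zmin n k] is a product
    of [k] generators moving [4 * k] points, and its conjugates move as many, so none is shorter. *)
Lemma support_ball (S : {set {perm Tn n}}) m w : (forall s, s \in S -> exists x, exists y, s = st x y) ->
  w \in ball S m -> #|support w| <= 4 * m.
Proof.
move=> HS; elim: m w => [|m IHm] w.
  rewrite inE => /eqP->; rewrite leqn0 cards_eq0; apply/eqP/setP=> x.
  by rewrite !inE perm1 eqxx.
rewrite /ball iterS -/(ball S m) => /setUP[/IHm|/mulsgP[u s uB /HS[x [y ->]] ->]].
  by move=> h; apply: leq_trans h _; lia.
have sub : support (u * st x y) \subset support u :|: support (st x y).
  by apply/subsetP=> a; rewrite !inE permM; case: (u a =P a) => // ->.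
have := leq_trans (subset_leq_card sub) (leq_card_setU _ _).
have := IHm u uB; have := support_st x y; lia.
Qed.

Lemma support_conj w v : #|support (w ^ v)| = #|support w|.
Proof.
rewrite -[RHS](card_imset _ (@perm_inj _ v)); congr #|pred_of_set _|; apply/setP=> x.
by rewrite -[x](permKV v) (mem_imset _ _ perm_inj) !inE permJ (inj_eq perm_inj).
Qed.

Lemma support_zmin k : 2 * k <= n -> 4 * k <= #|support (zmin n k)|.
Proof.
move=> kn; pose h (a : 'I_(2 * k) * bool) : Tn n := (widen_ord kn a.1, a.2).
have h_inj : injective h.
  by case=> i a [j c] [/val_inj/= E ->]; congr pair; apply: val_inj; exact: (congr1 val E).
have sub : h @: setT \subset support (zmin n k).
  apply/subsetP=> _ /imsetP[[i a] _ ->]; rewrite inE; apply/eqP=> /(congr1 fst)/(congr1 val) /=.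
  have [_ ->] := zminE (h (i, a)) kn; rewrite /= ltn_ord; apply/eqP/partner_neq.
have := subset_leq_card sub; rewrite card_imset // cardsT card_prod card_ord card_bool.
by have -> : (2 * k * 2 = 4 * k)%N by lia.
Qed.

Lemma zmin_ball (S : {set {perm Tn n}}) k : (forall i, i < k -> sA n (2 * i + 1) \in S) ->
  zmin n k \in ball S k.
Proof.
elim: k => [|k IHk] H; first by rewrite /zmin big_ord0 inE.
rewrite /ball iterS -/(ball S k) /zmin big_ord_recr /= -/(zmin n k).
by apply/setUP; right; apply: mem_mulg; [apply: IHk => i ik; apply: H; lia | apply: H].
Qed.

(** Either [zmin] fixes both points, or it exchanges their indices and the two reflections coincide,
    or the reflections have disjoint supports. *)
Lemma zmin_commutes k x y : 2 * k <= n -> (x.1 < 2 * k) = (y.1 < 2 * k) ->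
  commute (st (zmin n k x) (zmin n k y)) (st x y).
Proof.
move=> kn xy; set z := zmin n k; have zB := zmin_BC kn; have zn := BCP _ zB.
have zz a : z (z a) = a by rewrite -permM zmin_sq // perm1.
have fixz (a : Tn n) : (2 * k <= a.1)%N -> z a = a.
  move=> ha; have [E2 E1] := zminE a kn; apply: Tn_eq => //.
  by rewrite E1 ltnNge ha.
have movz (a : Tn n) : (a.1 < 2 * k)%N -> (z a).1 != a.1.
  move=> ha; rewrite -val_eqE /=; have [_ ->] := zminE a kn; rewrite ha; exact: partner_neq.
have [hx|hx] := ltnP x.1 (2 * k); last by rewrite !fixz // leqNgt -xy -leqNgt.
have hy : (y.1 < 2 * k)%N by rewrite -xy.
apply/esym/commgP/conjg_fixP; rewrite stJ ?st_BC //.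
have [E|E] := eqVneq (z x).1 y.1.
  have tx : st y x x = y by rewrite stC stL.
  have [Ez|Ez] := eq_fst E.
    have Ey : z y = x by rewrite -Ez zz.
    by rewrite Ez Ey stL tx stC.
  have Ey : z y = negT x by rewrite -[y]negTK -Ez zn zz.
  by rewrite Ez Ey st_neg stL tx stC.
have E' : (z y).1 != x.1.
  by apply: contra E => /eqP H; apply/eqP; rewrite -(BC_fst_eq zB H) zz.
by rewrite !st_out // eq_sym // movz.
Qed.

Definition block_st p s := exists x, exists y,
  [/\ s = st x y, (x.1 < p) = (y.1 < p) & (p <= x.1) -> x.2 = y.2].

Lemma model_triple_zmin (S J : {set {perm Tn n}}) k : 2 * k <= n -> J \subset S ->
  (forall s, s \in S -> exists x, exists y, s = st x y) ->
  (forall s, s \in J -> block_st (2 * k) s) ->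
  (forall i, i < k -> sA n (2 * i + 1) \in S) -> zmin n k \in <<J>> ->
  model_triple S J (zmin n k) (sigmaQ n (2 * k)).
Proof.
move=> kn JS Sst Jst SA zJ; set z := zmin n k in zJ *.
have Jblock : <<J>> \subset block n false (2 * k).
  by rewrite gen_subG; apply/subsetP=> s /Jst[x [y [-> xy1 xy2]]]; apply: st_block.
split=> //.
- rewrite /perfect_inv zJ zmin_sq // eqxx /=; apply/forall_inP=> t /imset2P[s w sJ wJ ->].
  have /blockP[wB w1 _] := subsetP Jblock w wJ.
  have [x [y [-> xy1 _]]] := Jst s sJ; rewrite stJ //.
  have c := @zmin_commutes k (w x) (w y) kn; rewrite !w1 in c; have {}c := c xy1.
  set r := st (w x) (w y) in c *; have zV : z^-1 = z by apply/eqP; rewrite eq_invg_mul zmin_sq.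
  have tt : r * r = 1 by apply: stK.
  (* The square of [z * r] is a product of two commuting involutions, so its fourth power is 1. *)
  have zt2 : (z * r) ^+ 2 = r ^ z * r by rewrite conjgE zV expgS expg1 !mulgA.
  have c' : r ^ z * r = r * r ^ z by rewrite /r stJ ?zmin_BC //.
  by rewrite -[4]/(2 * 2)%N expgM zt2 expgS expg1 {1}c' mulgA -(mulgA r) -conjMg tt conj1g mulg1 tt.
- apply/forall_inP=> s sJ; have [x [y ->]] := Sst s (subsetP JS _ sJ).
  have -> : st x y * z * st x y = z ^ st x y by rewrite conjgE stV mulgA.
  apply: clen_le_of_ball => m /(support_ball Sst); rewrite support_conj => h.
  apply: leq_trans (clen_le (zmin_ball SA)) _.
  have := support_zmin kn; rewrite -/z; lia.
split=> [w _|v w vJ wJ].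
  by rewrite /sigmaQ -signr_odd; case: (odd _); [right | left].
by apply: sigmaQM; apply: (subsetP Jblock).
Qed.

End ModelTriples.

(** * Induced characters *)

Section TripleCharacters.
Variable gT : finGroupType.
Implicit Types (J : {set gT}) (z : gT) (sigma : gT -> algC).

(** [cf_of] returns 0 on what is not a class function; the character of the one-dimensional
    representation given by [sigma] shows that this default is not taken. *)
Lemma cf_of_sign_hom J sigma : sign_hom J sigma ->
  cf_of <<J>>%G sigma \is a character /\ (forall x, x \in <<J>> -> cf_of <<J>>%G sigma x = sigma x).
Proof.
case=> vals mult; have s1 : sigma 1 = 1%R.
  have := mult 1 1 (group1 _) (group1 _); rewrite mulg1.
  case: (vals 1 (group1 _)) => -> //; rewrite mulrNN mulr1 => /eqP.
  by rewrite eq_sym -addr_eq0 -mulr2n pnatr_eq0.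
have rP : mx_repr <<J>>%G (fun x => (sigma x)%:M%R : 'M[algC]_1).
  by split=> [|x y xJ yJ]; rewrite ?s1 // mult // scalar_mxM.
have -> : cf_of <<J>>%G sigma = cfRepr (MxRepresentation rP).
  rewrite /cf_of [finfun _](_ : _ = val (cfRepr (MxRepresentation rP))); first exact: valKd.
  apply/ffunP=> x.
  rewrite ffunE -[RHS]/(cfRepr (MxRepresentation rP) x) cfunE mxtrace_scalar mulr1n.
  by case: (x \in <<J>>); rewrite ?mulr1n ?mulr0n.
split=> [|x xJ]; first exact: cfRepr_char.
by rewrite cfunE xJ mulr1n mxtrace_scalar mulr1n.
Qed.

Lemma triple_char_char (W : {group gT}) J z sigma : sign_hom J sigma ->
  triple_char W J z sigma \is a character.
Proof. by case/cf_of_sign_hom=> cJ _; apply/cfInd_char/cfRes_char. Qed.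

Lemma triple_charE (W : {group gT}) J z sigma g : sign_hom J sigma -> <<J>> \subset W ->
  (triple_char W J z sigma g = #|'C_(<<J>>)[z]|%:R^-1 *
    \sum_(w in W) if (g ^ w)%g \in 'C_(<<J>>)[z] then sigma (g ^ w)%g else 0)%R.
Proof.
move=> /cf_of_sign_hom[_ val] JW; have CJ : 'C_(<<J>>)[z] \subset <<J>> by apply: subsetIl.
rewrite /triple_char cfIndE ?(subset_trans CJ) //; congr (_ * _)%R; apply: eq_bigr => w _.
case: ifP => [gC|/negbT gC]; last by rewrite cfun0.
by rewrite cfResE // val // (subsetP CJ).
Qed.

End TripleCharacters.

(** * From root counts to perfect models *)

Section Assembly.
Variable n : nat.
Implicit Types (x y z : Tn n) (v w g : {perm Tn n}) (k p : nat).

Lemma fixin_base k : 2 * k <= n -> fixin (base n k) setT = tail n (2 * k).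
Proof.
move=> kn; apply/setP=> x; rewrite mem_fixin in_setT inE /=.
apply/eqP/andP => [E|[h x2]].
  have h : (2 * k <= x.1)%N by rewrite -base_fst // E.
  by move: E; rewrite ffunE ltnNge h /= => <-.
by rewrite ffunE ltnNge h /=; case: x x2 {h} => i [].
Qed.

(** The left-hand side is the model character at [g], with centralizers rewritten as stabilizers of
    [base n k]. *)
Definition root_sum_formula (W : {group {perm Tn n}}) := forall g, g \in W ->
  (\sum_(k < n./2.+1) #|[set w in W | commutes (base n k) w]|%:R^-1 * \sum_(w in W)
      (if commutes (base n k) (g ^ w) then sg (g ^ w) (fixin (base n k) setT) else 0) =
   #|[set x in W | (x * x)%g == g]|%:R :> algC)%R.

Lemma perfect_model_seq (W : {group {perm Tn n}}) (S : {set {perm Tn n}}) (J : nat -> {set {perm Tn n}}) :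
  (forall k, 2 * k <= n -> model_triple S (J k) (zmin n k) (sigmaQ n (2 * k))) ->
  (forall k, 2 * k <= n -> <<J k>> \subset W) ->
  (forall k, 2 * k <= n -> <<J k>> \subset block n false (2 * k)) ->
  (forall k, 2 * k <= n -> 'C_(<<J k>>)[zmin n k] = [set w in W | commutes (base n k) w]) ->
  (forall g, g \in W -> exists2 c, c \in W & g ^ c = g^-1) ->
  root_sum_formula W ->
  perfect_model W S [seq (J k, zmin n k, sigmaQ n (2 * k)) | k <- iota 0 (n./2).+1].
Proof.
move=> JS JW Jblock CE realW roots; set P := [seq _ | k <- _].
have kn (k : nat) : (k < n./2.+1)%N -> (2 * k <= n)%N by lia.
split=> [i|].
  have i_lt : (i < n./2.+1)%N by apply: leq_trans (ltn_ord i) _; rewrite size_map size_iota.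
  rewrite (tnth_nth (J 0, 1, sigmaQ n 0)) /= (nth_map 0%N) ?size_iota // nth_iota // add0n.
  exact: JS (kn _ i_lt).
rewrite big_map -[iota 0 _]/(index_iota 0 (n./2).+1) big_mkord.
have sh (k : nat) : (k < n./2.+1)%N -> sign_hom (J k) (sigmaQ n (2 * k)) by move=> /kn/JS[].
apply: (sum_irr_of_sqrt_count realW) => [|g gW].
  by apply: rpred_sum => k _; apply/triple_char_char/sh.
rewrite -roots // sum_cfunE; apply: eq_bigr => k _; have kn' := kn k (ltn_ord k).
rewrite /= (triple_charE _ _ (sh k (ltn_ord k)) (JW k kn')) (CE k kn').
congr (_ * _)%R; apply: eq_bigr => w wW.
rewrite inE groupJ //=; case: ifP => // cw; rewrite fixin_base //.
apply: (@sigmaQ_sg _ _ false); apply: (subsetP (Jblock k kn')).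
suff : g ^ w \in 'C_(<<J k>>)[zmin n k] by case/setIP.
by rewrite CE // inE groupJ.
Qed.

Lemma root_sum_signed b : root_sum_formula (signed n b).
Proof. by move=> g gS; apply: model_sum_roots. Qed.

Lemma signed_real b g : g \in signed n b -> exists2 c, c \in signed n b & g ^ c = g^-1.
Proof.
case/signedP=> gB gs; have [c cB [cg cs]] := BC_real gB; exists c => //.
by apply/signedP; split=> // bT; apply/cs/gs.
Qed.

Lemma JA_st p s : s \in JA n p -> block_st p s.
Proof.
case/imsetP=> i; rewrite inE => /andP[i0 ip] ->; have Ei := ord_pred_natE i0.
exists (ord_pred_nat i, false), (i, false); split=> //; first exact: sA_st.
by move: ip => /=; lia.
Qed.

Lemma JB_st p s : s \in JB n p -> block_st p s.
Proof.
case/imsetP=> i; rewrite inE /= => ip ->; rewrite /genBC; case: eqP => [i0|/eqP].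
  exists (i, false), (i, true); split=> //=; first exact: s0_st.
  by move: ip; rewrite i0; lia.
rewrite -lt0n => i0; apply: JA_st; apply/imsetP; exists i => //.
by rewrite inE i0.
Qed.

Lemma JD_st p s : (1 < n)%N -> p != 1%N -> s \in JD n p -> block_st p s.
Proof.
move=> n1 p1; case/imsetP=> i; rewrite inE /= => ip ->; rewrite /Defs.genD; case: eqP => [i0|/eqP].
  exists (i, false), (Ordinal n1, true); split=> //=; first exact: sm1_st.
    by move: ip p1; rewrite i0; lia.
  by move: ip p1; rewrite i0; lia.
rewrite -lt0n => i0; apply: JA_st; apply/imsetP; exists i => //.
by rewrite inE i0.
Qed.

Lemma block_false b p : block n b p \subset block n false p.
Proof.
apply/subsetP=> w /blockP[H1 H2 H3]; apply/blockP; split=> // x px; apply: H3.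
by move: px => /= ->; rewrite orbT.
Qed.

Lemma block_signed b p : block n b p \subset signed n b.
Proof.
apply/subsetP=> w /blockP[H1 _ H3]; apply/signedP; split=> // bT x; apply: H3.
by rewrite bT.
Qed.

Lemma zmin_block b k : (2 * k <= n)%N -> zmin n k \in block n b (2 * k).
Proof.
move=> kn; apply/blockP; split=> [|x|x _]; first exact: zmin_BC.
  have [_ ->] := zminE x kn; case: (ltnP x.1) => h; first by rewrite partner_lt.
  by rewrite ltnNge h.
by have [] := zminE x kn.
Qed.

Theorem perfect_model_signed (b : bool) (S : {set {perm Tn n}}) (J : nat -> {set {perm Tn n}}) :
  (forall p, <<J p>> = block n b p) -> (forall p s, s \in J p -> block_st p s) ->
  (forall p, J p \subset S) -> (forall s, s \in S -> exists x, exists y, s = st x y) ->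
  (forall i : 'I_n, (0 < i)%N -> sA n i \in S) ->
  perfect_model (signed n b) S [seq (J (2 * k)%N, zmin n k, sigmaQ n (2 * k)) | k <- iota 0 (n./2).+1].
Proof.
move=> JE Jst JS Sst SS; apply: (@perfect_model_seq _ _ (fun k => J (2 * k)%N)).
- move=> k kn; apply: model_triple_zmin => //; first exact: Jst.
    move=> i ik; have lt_i : (2 * i + 1 < n)%N by lia.
    by apply: (SS (Ordinal lt_i)) => /=; lia.
  by rewrite JE zmin_block.
- by move=> k kn; rewrite JE block_signed.
- by move=> k kn; rewrite JE block_false.
- by move=> k kn; rewrite JE cent_zminE.
- exact: signed_real.
exact: root_sum_signed.
Qed.

End Assembly.

Theorem perfect_model_A m : perfect_model (WA m) (SA m) (PA m).
Proof.
have -> : WA m = signed m true by apply: val_inj; rewrite /= WA_block.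
apply: (@perfect_model_signed m true (SA m) (JA m)).
- exact: gen_JA.
- exact: JA_st.
- move=> p; apply/subsetP=> _ /imsetP[i iP ->]; apply/imsetP; exists i => //.
  by move: iP; rewrite !inE => /andP[].
- move=> s; rewrite SA_JA => /JA_st[x [y [-> _ _]]]; by exists x, y.
move=> i i0; apply/imsetP; exists i => //; by rewrite inE.
Qed.

Theorem perfect_model_BC n : perfect_model (WBC n) (SBC n) (PBC n).
Proof.
apply: (@perfect_model_signed n false (SBC n) (JB n)).
- exact: gen_JB.
- exact: JB_st.
- by move=> p; apply/subsetP=> _ /imsetP[i _ ->]; apply/imsetP; exists i.
(* Taking [p = n] omits no generator, so the description of [JB] covers all of [SBC n]. *)
- move=> s sS; suff /JB_st[x [y [-> _ _]]] : s \in JB n n by exists x, y.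
  case/imsetP: sS => i _ ->; apply/imsetP; exists i => //.
  by rewrite inE /= neq_ltn ltn_ord.
by move=> i i0; apply/imsetP; exists i; rewrite // /genBC -[_ == _]negbK -lt0n i0.
Qed.

(** * Type D of odd rank *)

Section OddD.
Variable n : nat.
Hypothesis n_odd : odd n.
Implicit Types (x y z : Tn n) (v w g : {perm Tn n}) (k p : nat).

Lemma nsign_neg_perm : nsign (neg_perm n) = true.
Proof.
have E : odd (\sum_(i < n) 1) = \big[addb/false]_(i < n) true.
  exact: (big_morph odd oddD erefl).
rewrite /nsign (eq_bigr (fun _ => true)) => [|i _]; last by rewrite neg_permE.
by rewrite -E sum1_card card_ord.
Qed.

Lemma BC_neg_comm w : w \in BCset n -> w * neg_perm n = neg_perm n * w.
Proof. by move=> /BCP wn; apply/permP=> x; rewrite !permM !neg_permE wn. Qed.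

Lemma neg_perm_sq : neg_perm n * neg_perm n = 1.
Proof. by apply/permP=> x; rewrite permM perm1 !neg_permE negTK. Qed.

(* As [n] is odd, [W^BC_n] is the direct product of [W^D_n] and its center [{1, -1}]. *)
Lemma sum_BC_D (R : comNzRingType) (F : {perm Tn n} -> R) :
  (forall w, w \in BCset n -> F (w * neg_perm n) = F w) ->
  (\sum_(w in BCset n) F w = 2%:R * \sum_(w in Dset n) F w)%R.
Proof.
move=> FE; have nB := neg_perm_BC n.
have DE w : (w \in Dset n) = (w \in BCset n) && ~~ nsign w by rewrite in_set.
rewrite (bigID (fun w => w \in Dset n)) /= mulr_natl mulr2n; congr (_ + _)%R.
  by apply: eq_bigl => w; rewrite DE; case: (w \in BCset n).
rewrite (reindex_inj (mulIg (neg_perm n))) /=; apply: eq_big => [w|w /andP[wB _]].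
  rewrite !DE (groupMr (G := WBC n)) //; have [wB|//] := boolP (w \in BCset n).
  by rewrite nsignM // nsign_neg_perm addbT negbK.
by rewrite FE //; move: wB; rewrite (groupMr (G := WBC n)).
Qed.

(** Commuting with [zmin], [w] has the same sign at the two indices of each couple, so the signs
    below [2 * k] cancel in pairs; beyond there are none. Hence the stabilizers in types BC and D
    coincide. *)
Lemma stab_nsign k w : (2 * k <= n)%N -> w \in BCset n -> commutes (base n k) w -> nsign w = false.
Proof.
move=> kn wB cw; have : w \in 'C_(block n false (2 * k))[zmin n k].
  by rewrite cent_zminE // inE cw andbT.
case/setIP=> /blockP[_ _ w2] /cent1P zw.
have wz x : w (zmin n k x) = zmin n k (w x) by rewrite -!permM zw.
pose pi (i : 'I_n) : 'I_n := (zmin n k (i, false)).1.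
have piE (i : 'I_n) : (i < 2 * k)%N -> pi i = partner i :> nat.
  by move=> ik; have [_ E] := zminE (i, false) kn; rewrite /pi E ik.
have zE i : zmin n k (i, false) = (pi i, false).
  by have [E _] := zminE (i, false) kn; apply: Tn_eq => //; rewrite E.
have pi_inv : involutive pi.
  by move=> i; have := zE (pi i); rewrite -(zE i) -permM zmin_sq // perm1 => -[].
have pi_sign i : (w (pi i, false)).2 = (w (i, false)).2.
  by rewrite -zE wz; have [-> _] := zminE (w (i, false)) kn.
rewrite /nsign (bigID (fun i : 'I_n => (i < 2 * k)%N)) /= [X in _ (+) X]big1 ?addbF => [|i ik]; last first.
  by rewrite w2 //= leqNgt.
rewrite (bigID (fun i : 'I_n => odd i)) /= [X in _ (+) X](reindex_inj (inv_inj pi_inv)) /=.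
rewrite [X in _ (+) X](eq_bigr (fun i : 'I_n => (w (i, false)).2)) => [|i _]; last exact: pi_sign.
rewrite [X in _ (+) X](eq_bigl (fun i : 'I_n => (i < 2 * k)%N && odd i)); first by rewrite addbb.
move=> i; have [ik|ik] := ltnP i (2 * k).
  rewrite piE // partner_lt //= /partner; case: ifP => oi /=; last by rewrite oi.
  by move: oi; lia.
have -> : pi i = i; last by rewrite ltnNge ik.
by apply: val_inj; have [_ E] := zminE (i, false) kn; rewrite /pi /= E /= ltnNge ik.
Qed.

Lemma stab_D k : (2 * k <= n)%N ->
  [set w in WD n | commutes (base n k) w] = [set w in signed n false | commutes (base n k) w].
Proof.
move=> kn; apply/setP=> w; apply/setIdP/setIdP => [[/DP[wB _] cw]|[wB cw]] //.
by split=> //; apply/DP; rewrite (stab_nsign kn wB cw).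
Qed.

(** As [neg_perm n] is central with square 1, the summands on both sides are unchanged when it
    multiplies the summation variable. The stabilizers being equal, both sides of the BC formula are
    twice those for D. *)
Lemma root_sum_D : root_sum_formula (WD n).
Proof.
move=> g gD; have [gB _] := DP _ gD; have kn (k : 'I_n./2.+1) : (2 * k <= n)%N.
  by have := ltn_ord k; lia.
have two0 : (2%:R != 0 :> algC)%R by rewrite pnatr_eq0.
apply: (mulfI two0); have := @root_sum_signed n false g gB.
have -> : (#|[set x in signed n false | (x * x)%g == g]|%:R =
    2%:R * #|[set x in WD n | (x * x)%g == g]|%:R :> algC)%R.
  have cE (A : {set {perm Tn n}}) : (#|[set x in A | (x * x)%g == g]|%:R =
      \sum_(x in A) (if (x * x)%g == g then 1 else 0) :> algC)%R.
    by rewrite -sum1_card natr_sum -big_mkcondr; apply: eq_bigl => x; rewrite inE.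
  rewrite !cE; apply: sum_BC_D => w wB.
  by rewrite {2}(BC_neg_comm wB) mulgA -[_ * _ * neg_perm n]mulgA neg_perm_sq mulg1.
move=> <-; rewrite mulr_sumr; apply: eq_bigr => k _; rewrite stab_D // mulrCA; congr (_ * _)%R.
apply/esym/sum_BC_D => w wB; suff -> : g ^ (w * neg_perm n) = g ^ w by [].
rewrite conjgM; apply/conjg_fixP/commgP/esym; rewrite /commute BC_neg_comm //.
by rewrite (groupJ (G := WBC n)).
Qed.

(** If [c] inverts [g], so does its product with the central [neg_perm n], and one of the two lies
    in [WD n]. *)
Lemma D_real g : g \in WD n -> exists2 c, c \in WD n & g ^ c = g^-1.
Proof.
case/DP=> gB _; have [c cB [cg _]] := BC_real gB; have nB := neg_perm_BC n.
have [nc|nc] := boolP (nsign c); last by exists c => //; apply/DP; split=> //; apply/negbTE.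
exists (neg_perm n * c).
  by apply/DP; rewrite nsignM // nc nsign_neg_perm; split=> //; apply: (groupM (G := WBC n)).
rewrite conjgM; suff -> : g ^ neg_perm n = g by [].
by apply/conjg_fixP/commgP/esym; rewrite /commute BC_neg_comm.
Qed.

Lemma zmin_D k : (2 * k <= n)%N -> zmin n k \in Dset n.
Proof.
move=> kn; apply/DP; split; first exact: zmin_BC.
by apply: nsign_sign0 => x; have [] := zminE x kn.
Qed.

Theorem perfect_model_D : (1 < n)%N -> perfect_model (WD n) (SD n) (PD n).
Proof.
move=> n1; have p1 k : (2 * k)%N != 1%N by lia.
(* The extra triple of type D is the member [k = 0] of the family, where [zmin] is an empty
   product. *)
have -> : PD n = [seq (JD n (2 * k), zmin n k, sigmaQ n (2 * k)) | k <- iota 0 (n./2).+1].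
  have z0 : zmin n 0 = 1 by rewrite /zmin big_ord0.
  by rewrite -[iota 0 _]/(0%N :: iota 1 n./2) map_cons z0.
have JE k : <<JD n (2 * k)>> = block n false (2 * k) :&: Dset n by apply: gen_JD.
have SA i : (0 < i)%N -> (i < n)%N -> sA n i \in SD n.
  move=> i0 lt_i; apply/imsetP; exists (Ordinal lt_i) => //.
  by rewrite /Defs.genD /= -[_ == _]negbK -lt0n i0.
apply: (@perfect_model_seq _ _ _ (fun k => JD n (2 * k)%N)).
- move=> k kn; apply: model_triple_zmin => //.
  + by apply/subsetP=> _ /imsetP[i _ ->]; apply/imsetP; exists i.
  + move=> s sS; have nn1 : n != 1%N by lia.
    suff /(JD_st n1 nn1)[x [y [-> _ _]]] : s \in JD n n by exists x, y.
    case/imsetP: sS => i _ ->; apply/imsetP; exists i => //.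
    by rewrite inE /= neq_ltn ltn_ord.
  + by move=> s; apply: (JD_st n1 (p1 k)).
  + by move=> i ik; apply: SA; lia.
  by rewrite JE inE zmin_block // zmin_D.
- by move=> k _; rewrite JE subsetIr.
- by move=> k _; rewrite JE subsetIl.
- move=> k kn; rewrite JE stab_D // -cent_zminE // -setIA (setIC (Dset n)) setIA.
  apply/setIidPl; rewrite cent_zminE // -stab_D //.
  by apply/subsetP=> w /setIdP[].
- exact: D_real.
exact: root_sum_D.
Qed.

End OddD.

Local Close Scope group_scope.

Theorem mainTheorem1 :
  (forall m : nat, 1 <= m -> perfect_model (WA m) (SA m) (PA m)) /\
  (forall n : nat, 2 <= n -> perfect_model (WBC n) (SBC n) (PBC n)) /\
  (forall n : nat, 2 <= n ->
     perfect_model (WD (2 * n + 1)) (SD (2 * n + 1)) (PD (2 * n + 1))).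
Proof.
split=> [m _|]; first exact: perfect_model_A.
split=> n n2; first exact: perfect_model_BC.
by apply: perfect_model_D; lia.
Qed.
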